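(* Let $d\ge2$, let $\Xi$ be a homogeneous point process in $\mathbb{R}^d$ and, for $L>0$, let $\Xi_L=L^{-1/d}\,\Xi$ be its dilation by a factor $L^{-1/d}$. Fix a nonempty open bounded convex set $\Omega\subset\mathbb{R}^d$. Assume that there is a constant $C_0>0$ such that for all $L\ge1$ and every function $f\in L^2(\Omega)$ (extended by $0$ outside $\Omega$) $$\operatorname{Var}\left(\sum_{x\in\Xi_L}f(x)\right)\le C_0\,L\,\|f\|_{L^2(\Omega)}^2 .$$ Let $N=\#(\Xi_L\cap\Omega)$. Then there are constants $C>0$ and $L_0\ge2$ such that for all $L\ge L_0$ $$\mathbb{E}\,W_2\left(\frac1N\sum_{x\in\Xi_L\cap\Omega}\delta_x,\ \frac{1}{\operatorname{Vol}(\Omega)}\operatorname{Vol}|_\Omega\right)\le\begin{cases} C\,\dfrac{\sqrt{\log L}}{\sqrt L}, & d=2,\\[2mm] C\,\dfrac{1}{L^{1/d}}, & d>2.\end{cases}$$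
   Context: A (simple) point process is a random subset of $\mathbb{R}^d$ without accumulation points. It is homogeneous if its first intensity (with respect to Lebesgue measure) is a constant $c>0$, i.e. $\mathbb{E}\sum_{x\in\Xi}f(x)=c\int f(x)\,dx$ for measurable $f\geq 0$; then $\Xi_L$ has first intensity $cL$. $\operatorname{Vol}$ is Lebesgue measure. For finite positive measures $\mu,\nu$ of equal total mass, $W_2(\mu,\nu)=\left(\inf_\pi\int|x-y|^2d\pi(x,y)\right)^{1/2}$, the infimum being over positive measures $\pi$ on the product with marginals $\mu,\nu$. Convention: on the event $N=0$, where the empirical measure is undefined, the $W_2$ term is given the value $\operatorname{diam}(\Omega)$. *)

(* Defs.v *)
From HB Require Import structures.
From mathcomp Require Import all_boot all_order all_algebra.
From mathcomp Require Import finmap.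
From mathcomp Require Import all_classical all_reals all_analysis.
From mathcomp Require Import measurable_realfun.

Set Implicit Arguments.
Unset Strict Implicit.
Unset Printing Implicit Defensive.

Import Order.TTheory GRing.Theory Num.Theory.
Import numFieldNormedType.Exports.

Local Open Scope classical_set_scope.
Local Open Scope ring_scope.

Definition measure_rV_display : measure_display.
Proof. exact. Qed.

(* The sigma-algebra of R^n is generated by the coordinate maps (as for
   [n.-tuple T] in the library); it is the Borel sigma-algebra of the topology
   of ['rV[R]_n], see [measurable_open_rV]. *)
Section measurable_rV.
Context {R : realType} (n : nat).

Let coors : 'I_n -> 'rV[R]_n -> R := fun i v => v 0 i.

Let rV_set0 : g_sigma_preimage coors set0.
Proof. exact: sigma_algebra0. Qed.

Let rV_setC A : g_sigma_preimage coors A -> g_sigma_preimage coors (~` A).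
Proof. exact: sigma_algebraC. Qed.

Let rV_bigcup (F : _^nat) : (forall i, g_sigma_preimage coors (F i)) ->
  g_sigma_preimage coors (\bigcup_i (F i)).
Proof. exact: sigma_algebra_bigcup. Qed.

HB.instance Definition _ := @isMeasurable.Build measure_rV_display
  'rV[R]_n (g_sigma_preimage coors) rV_set0 rV_setC rV_bigcup.

End measurable_rV.

Section measurable_rV_theory.
Context {R : realType}.

Lemma measurable_coord n (i : 'I_n) :
  measurable_fun [set: 'rV[R]_n] (fun v : 'rV[R]_n => v 0 i).
Proof.
move=> _ Y mY; rewrite setTI; apply: sub_sigma_algebra => /=.
rewrite -bigcup_seq/=; exists i => /=; first by rewrite mem_index_enum.
by exists Y => //; rewrite setTI.
Qed.

Lemma measurable_fun_rV d (T : measurableType d) n (f : T -> 'rV[R]_n) :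
  (forall i, measurable_fun setT (fun t => f t 0 i)) -> measurable_fun setT f.
Proof.
move=> mf _ Y mY; rewrite setTI.
pose G := [set A : set 'rV[R]_n | measurable (f @^-1` A)].
suff : G Y by [].
move: Y mY; apply: smallest_sub.
  split => /=.
  - by rewrite /G/= preimage_set0.
  - by move=> A; rewrite /G/= setTD preimage_setC => /measurableC.
  - by move=> F mF; rewrite /G/= preimage_bigcup; apply: bigcupT_measurable.
rewrite -bigcup_seq; apply: bigcup_sub => i _ _ [B mB <-].
by rewrite /G/= setTI; have := mf i measurableT B mB; rewrite setTI.
Qed.

Lemma measurable_box n (A : 'I_n -> set R) : (forall i, measurable (A i)) ->
  measurable [set v : 'rV[R]_n | forall i, A i (v 0 i)].
Proof.
move=> mA; rewrite (_ : [set _ | _] =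
    \bigcap_i ((fun v : 'rV[R]_n => v 0 i) @^-1` A i)); last first.
  by apply/seteqP; split=> [v Av i _|v Av i]; exact: Av.
apply: fin_bigcap_measurable => [|i _]; first exact: finite_finset.
by rewrite -[X in measurable X]setTI; exact: measurable_coord.
Qed.

Lemma measurable_open_rV n (A : set 'rV[R]_n) : open A -> measurable A.
Proof.
move=> oA.
pose B (q : 'rV[rat]_n * nat) : set 'rV[R]_n :=
  [set v | forall i, ball (ratr (q.1 0 i) : R) q.2.+1%:R^-1 (v 0 i)].
have -> : A = \bigcup_(q in [set q | B q `<=` A]) B q.
  apply/seteqP; split=> [v Av|v [q /= BA Bv]]; last exact: BA.
  have [e /= e0 veA] : nbhs_ball v A by rewrite nbhs_ballE; exact: open_nbhs_nbhs.
  have [k /= ke] : exists k : nat, k.+1%:R^-1 < e / 2.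
    have /ltr_add_invr[k] : 0 < e / 2 by rewrite divr_gt0.
    by rewrite add0r => ?; exists k.
  have k0 : 0 < k.+1%:R^-1 :> R by rewrite invr_gt0 ltr0n.
  have /choice[q vq] : forall i, exists q : rat, ball (v 0 i) k.+1%:R^-1 (ratr q : R).
    move=> i; have : v 0 i < v 0 i + k.+1%:R^-1 by rewrite ltrDl.
    move=> /rat_in_itvoo[q /itvP qv]; exists q.
    rewrite /ball/= ltr_distlC; apply/andP; split; last by rewrite qv.
    by rewrite (lt_trans _ (_ : v 0 i < _))// ?qv// ltrBlDr ltrDl.
  exists (\row_i q i, k) => [w /= Bw|i /=]; last by rewrite mxE; exact: ball_sym.
  apply: veA; split => // i j; rewrite ord1.
  apply: (@le_ball _ _ _ (k.+1%:R^-1 + k.+1%:R^-1)).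
    by rewrite [leRHS]splitr lerD// ltW.
  apply: ball_triangle (vq j) _.
  by have := Bw j; rewrite mxE.
rewrite bigcup_mkcond; apply: countable_bigcupT_measurable => [|q].
  exact: countableP.
case: ifPn => // _; apply: (@measurable_box n (fun i => ball (ratr (q.1 0 i) : R) _)) => i.
exact: measurable_ball.
Qed.

Definition cons_rV n (p : measurableTypeR R * 'rV[R]_n) : 'rV[R]_n.+1 :=
  row_mx (p.1 : R)%:M p.2.

Lemma cons_rV0 n p : @cons_rV n p 0 ord0 = p.1.
Proof.
transitivity (row_mx (p.1 : R)%:M p.2 0 (lshift n (0 : 'I_1))).
  by congr (row_mx _ _ 0 _); exact/val_inj.
by rewrite row_mxEl mxE eqxx mulr1n.
Qed.

Lemma cons_rVS n p i : @cons_rV n p 0 (lift ord0 i) = p.2 0 i.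
Proof.
transitivity (row_mx (p.1 : R)%:M p.2 0 (rshift 1 i)).
  by congr (row_mx _ _ 0 _); exact/val_inj.
by rewrite row_mxEr.
Qed.

Lemma measurable_cons_rV n : measurable_fun setT (@cons_rV n).
Proof.
apply: measurable_fun_rV => i; case: (unliftP ord0 i) => [j|] ->.
  under eq_fun do rewrite cons_rVS.
  exact: (measurableT_comp (measurable_coord j) measurable_snd).
by under eq_fun do rewrite cons_rV0; exact: measurable_fst.
Qed.

End measurable_rV_theory.

Section lebesgue_rV.
Context {R : realType}.
Local Open Scope ereal_scope.

Section lebesgue_cons.
Context n (m : {sigma_finite_measure set 'rV[R]_n -> \bar R}).

Definition lebesgue_cons : set 'rV[R]_n.+1 -> \bar R :=
  pushforward (@lebesgue_measure R \x m) (@cons_rV R n).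

Let lebesgue_cons0 : lebesgue_cons set0 = 0.
Proof. by rewrite /lebesgue_cons /pushforward preimage_set0 measure0. Qed.

Let lebesgue_cons_ge0 A : 0 <= lebesgue_cons A.
Proof. by rewrite /lebesgue_cons /pushforward; exact: measure_ge0. Qed.

Let lebesgue_cons_sigma_additive : semi_sigma_additive lebesgue_cons.
Proof.
move=> F mF tF mUF; rewrite /lebesgue_cons /pushforward preimage_bigcup.
have mcons A : measurable A -> measurable (@cons_rV R n @^-1` A).
  by move=> mA; rewrite -[X in measurable X]setTI; exact: measurable_cons_rV.
apply: measure_semi_sigma_additive => [k||]; first exact: mcons.
- apply/trivIsetP => /= i j _ _ ij; rewrite -preimage_setI.
  by move/trivIsetP : tF => /(_ _ _ _ _ ij) ->//; rewrite preimage_set0.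
- by rewrite -preimage_bigcup; exact: mcons.
Qed.

HB.instance Definition _ := isMeasure.Build _ _ _ lebesgue_cons
  lebesgue_cons0 lebesgue_cons_ge0 lebesgue_cons_sigma_additive.

Lemma lebesgue_cons_box (A : 'I_n.+1 -> set R) :
  (forall i, measurable (A i)) ->
  lebesgue_cons [set v | forall i, A i (v 0%R i)] =
  lebesgue_measure (A ord0) *
  m [set v | forall i, A (lift ord0 i) (v 0%R i)].
Proof.
move=> mA; rewrite -product_measure1E; last first.
- exact: (measurable_box (A := fun i => A (lift ord0 i))).
- exact: mA.
rewrite /lebesgue_cons /pushforward; congr (product_measure1 _ _ _).
apply/seteqP; split=> [p Ap|p [Ap0 ApS] i] /=.
  split=> [|i]; first by have := Ap ord0; rewrite cons_rV0.
  by have := Ap (lift ord0 i); rewrite cons_rVS.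
by case: (unliftP ord0 i) => [j|] ->; rewrite ?cons_rVS ?cons_rV0//; exact: ApS.
Qed.

Let lebesgue_cons_sigma_finite : sigma_finite setT lebesgue_cons.
Proof.
have /sigma_finiteP[F [TF ndF Foo]] := sigma_finiteT (@lebesgue_measure R).
have /sigma_finiteP[G [TG ndG Goo]] := sigma_finiteT m.
pose g (v : 'rV[R]_n.+1) : measurableTypeR R * 'rV[R]_n :=
  ((v 0%R ord0 : R), \row_i v 0%R (lift ord0 i)).
have mg : measurable_fun setT g.
  apply/measurable_fun_pairP; split; first exact: measurable_coord.
  apply: measurable_fun_rV => i.
  rewrite (_ : (fun _ => _) = fun v : 'rV[R]_n.+1 => v 0%R (lift ord0 i)).
    exact: measurable_coord.
  by apply/funext => v; rewrite /g/= mxE.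
have gK : cancel (@cons_rV R n) g.
  case=> x v; rewrite /g cons_rV0; congr (_, _).
  by apply/rowP => i; rewrite mxE cons_rVS.
exists (fun k => g @^-1` (F k `*` G k)).
  apply/esym; rewrite -subTset => v _.
  have : [set: measurableTypeR R] (g v).1 by [].
  have : [set: 'rV[R]_n] (g v).2 by [].
  rewrite TG TF => -[k _ Gkv] [l _ Flv]; exists (maxn k l) => //; split.
  - by move: Flv; apply/subsetPset/ndF/leq_maxr.
  - by move: Gkv; apply/subsetPset/ndG/leq_maxl.
move=> k; have [mF Fkoo] := Foo k; have [mG Gkoo] := Goo k; split.
  by rewrite -[X in measurable X]setTI; apply: mg => //; exact: measurableX.
rewrite /lebesgue_cons /pushforward -comp_preimage.
rewrite (_ : g \o @cons_rV R n = id); last by apply/funext => p; exact: gK.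
by rewrite preimage_id product_measure1E// lte_mul_pinfty// ge0_fin_numE.
Qed.

HB.instance Definition _ := @Measure_isSigmaFinite.Build _ _ _ lebesgue_cons
  lebesgue_cons_sigma_finite.

End lebesgue_cons.

(* Lebesgue measure on R^n as an iterated product of the one-dimensional
   Lebesgue measure; it is pinned down by [lebesgue_rV_box]. *)
Fixpoint lebesgue_rV n : {sigma_finite_measure set 'rV[R]_n -> \bar R} :=
  match n with
  | 0%N => dirac (0 : 'rV[R]_0)%R
  | n'.+1%N => lebesgue_cons (lebesgue_rV n')
  end.

Lemma lebesgue_rV_box n (A : 'I_n -> set R) : (forall i, measurable (A i)) ->
  lebesgue_rV n [set v | forall i, A i (v 0%R i)] =
  \big[mule/1]_(i < n) lebesgue_measure (A i).
Proof.
elim: n A => [|n IH] A mA /=.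
  by rewrite big_ord0 diracE mem_set// => -[].
by rewrite big_ord_recl lebesgue_cons_box// (IH (fun i => A (lift ord0 i))).
Qed.

End lebesgue_rV.

Section euclidean.
Context {R : realType} (n : nat).

(* The norm of the library on ['rV[R]_n] is the sup norm. *)
Definition enorm (v : 'rV[R]_n) : R := Num.sqrt (\sum_i v 0 i ^+ 2).

Definition ediam (D : set 'rV[R]_n) : \bar R :=
  ereal_sup [set (enorm (z.1 - z.2))%:E | z in D `*` D].

End euclidean.

Section measures_rV.
Context {R : realType} (n : nat).
Local Open Scope ereal_scope.

Section empirical_measure.
Variable X : {fset 'rV[R]_n}.

Definition empirical_measure (A : set 'rV[R]_n) : \bar R :=
  (#|` X|%:R^-1)%:E * \sum_(x <- X) \d_x A.

Let inv_ge0 : (0 <= #|` X|%:R^-1 :> R)%R.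
Proof. by rewrite invr_ge0. Qed.

Let m : {measure set 'rV[R]_n -> \bar R} := mscale (NngNum inv_ge0)
  (msum (fun k => \d_(nth (0 : 'rV[R]_n)%R X k)) (size X)).

Let empirical_measureE : empirical_measure = m.
Proof.
apply/funext => A; rewrite /m/= /mscale/= /msum /empirical_measure.
by congr (_ * _); rewrite (big_nth (0 : 'rV[R]_n)%R) big_mkord.
Qed.

Let empirical0 : empirical_measure set0 = 0.
Proof. by rewrite empirical_measureE measure0. Qed.

Let empirical_ge0 A : 0 <= empirical_measure A.
Proof. by rewrite empirical_measureE measure_ge0. Qed.

Let empirical_sigma_additive : semi_sigma_additive empirical_measure.
Proof. by rewrite empirical_measureE; exact: measure_semi_sigma_additive. Qed.

HB.instance Definition _ := isMeasure.Build _ _ _ empirical_measure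
  empirical0 empirical_ge0 empirical_sigma_additive.

End empirical_measure.

Section normalized_volume.
Variables (D : set 'rV[R]_n) (mD : measurable D).

Definition normalized_volume & measurable D := fun A : set 'rV[R]_n =>
  ((fine (lebesgue_rV n D))^-1)%:E * lebesgue_rV n (A `&` D).

Let inv_ge0 : (0 <= (fine (lebesgue_rV n D))^-1)%R.
Proof. by rewrite invr_ge0 fine_ge0. Qed.

Let m : {measure set 'rV[R]_n -> \bar R} :=
  mscale (NngNum inv_ge0) (mrestr (lebesgue_rV n) mD).

Let normalized0 : normalized_volume mD set0 = 0.
Proof. exact: (measure0 m). Qed.

Let normalized_ge0 A : 0 <= normalized_volume mD A.
Proof. exact: (measure_ge0 m). Qed.

Let normalized_sigma_additive : semi_sigma_additive (normalized_volume mD).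
Proof. exact: (@measure_semi_sigma_additive _ _ _ m). Qed.

HB.instance Definition _ := isMeasure.Build _ _ _ (normalized_volume mD)
  normalized0 normalized_ge0 normalized_sigma_additive.

End normalized_volume.

Definition coupling (mu nu : {measure set 'rV[R]_n -> \bar R}) :
    set {measure set ('rV[R]_n * 'rV[R]_n) -> \bar R} :=
  [set pi | forall A, measurable A ->
    pi (A `*` setT) = mu A /\ pi (setT `*` A) = nu A].

Definition W2 (mu nu : {measure set 'rV[R]_n -> \bar R}) : \bar R :=
  sqrte (ereal_inf [set \int[pi]_z (enorm (z.1 - z.2) ^+ 2)%:E
                   | pi in coupling mu nu]).

End measures_rV.

Section point_processes.
Context d {T : measurableType d} {R : realType} (P : probability T R) (n : nat).
Implicit Type Xi : T -> set 'rV[R]_n.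

(* Measurability of [Xi] is that of the numbers of points in Borel sets. *)
Definition point_process Xi :=
  (forall w, limit_point (Xi w) = set0) /\
  (forall A, measurable A ->
     measurable_fun setT (fun w => counting (Xi w `&` A) : \bar R)).

Definition homogeneous Xi :=
  exists2 c : R, 0 < c &
    forall f : 'rV[R]_n -> \bar R, measurable_fun setT f ->
      (forall x, 0 <= f x)%E ->
      (\int[P]_w (\esum_(x in Xi w) f x)
       = c%:E * \int[lebesgue_rV n]_x f x)%E.

Definition dilation (L : R) Xi : T -> set 'rV[R]_n :=
  fun w => [set (L `^ (- n%:R^-1)) *: x | x in Xi w].

End point_processes.

Section matching_error.
Context {R : realType} (n : nat) (D : set 'rV[R]_n) (mD : measurable D).

(* [fset_set] is junk ([fset0]) on infinite sets; a set without accumulation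
   points meets a bounded set in finitely many points. *)
Definition points_in (S : set 'rV[R]_n) : {fset 'rV[R]_n} := fset_set (S `&` D).

(* Without points in [D] the empirical measure is undefined, and the error is
   by convention the diameter of [D]. *)
Definition W2_error (S : set 'rV[R]_n) : \bar R :=
  let X := points_in S in
  if #|` X| == 0%N then ediam D
  else W2 (empirical_measure X) (normalized_volume mD).

End matching_error.

(* Main.v *)
(* Cut [Omega] into the images of [2^(K d)] cubes under a bi-Lipschitz map, with
   [2^(K d) ~ L], and let [h ~ L^(-1/d)] be the size of a cell.  A flow [j]
   between neighbouring cells whose divergence is the difference of the two cell
   masses can be run as a Markov chain from the volume to the points: at every
   step, a fixed fraction of what remains to be moved follows [j].  Its drift and
   its fluctuations both cost at most a multiple of
   [h^2 (1 + sum_b (outflow j b)^2 / vol b)], so this also bounds [W2^2] (a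
   discrete form of the bound of [W2] by a negative Sobolev norm; it only uses the
   lower bound on the density of the volume).

   The flow is explicit: a unit mass in the cell [x] is spread over the dyadic
   cubes containing [x], one coordinate at a time.  Hence the flux through a face
   near [b] is a linear statistic of the points, with a kernel of size
   [dist(b, x)^(1-d)]; by the variance hypothesis its second moment is bounded by
   the square of the L^2 norm of the kernel, which is of order
   [sum_(k < K) 2^((2-d) k)], that is [log L] if [d = 2] and [1] if [d > 2]. *)

Require Import Defs.
From HB Require Import structures.
From mathcomp Require Import all_boot all_order all_algebra.
From mathcomp Require Import finmap.
From mathcomp Require Import all_classical all_reals all_analysis.
From mathcomp Require Import measurable_realfun.
From mathcomp Require Import ring lra zify.

Set Implicit Arguments.
Unset Strict Implicit.
Unset Printing Implicit Defensive.

Import Order.TTheory GRing.Theory Num.Theory.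
Import numFieldNormedType.Exports.

Local Open Scope classical_set_scope.
Local Open Scope ring_scope.

(** * Transport along a flow on a finite set *)

(** Three obstacles shape the proof. The cells of [Omega] have unequal volumes, while the dyadic
    spreading ends in the law giving equal mass to all cells; as only the difference of two
    probability vectors is transported, this common end point cancels. The empirical measure carries
    a random factor [1 / N]; once the kernel of a face is centred by its volume average, the flux
    through the face is exactly minus a mean-zero linear statistic divided by [N]. Where [N] exceeds
    half its mean, [N] is replaced by that mean; elsewhere the diameter bound is absorbed in the
    variance of [N], at a cost of order [1 / L]. Finally, the available bound is on the square of
    [W2]: the square root is linearised at the target rate [r], so that only second moments of
    linear statistics have to be integrated. In two dimensions the exact power of the logarithm
    needs one more point: the supports of the kernels at successive scales are nested, and so the
    square of the sum over scales is comparable to the sum of the squares. *)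

Section discrete_transport.
Context {R : realType} {S I : finType} (x : I -> S -> R).
Implicit Types (rho sigma : S -> R) (pi j : S -> S -> R).

Definition discrete_coupling rho sigma pi :=
  [/\ forall a b, 0 <= pi a b, forall a, \sum_b pi a b = rho a
    & forall b, \sum_a pi a b = sigma b].

Definition coord_cost pi (i : I) := \sum_a \sum_b pi a b * (x i a - x i b) ^+ 2.

Definition outflow j b := \sum_c j b c.
Definition inflow j c := \sum_b j b c.

(** [F b c / rho b] is a Markov kernel: it follows [j] and keeps in place what does not leave [b].
    The new coupling is [pi] composed with it. Expanding the square around [x i b] leaves a drift
    term, bounded by AM-GM with the free weight [alpha], and a fluctuation term of size [h ^+ 2]
    times the outflow. *)
Lemma discrete_coupling_step rho0 rho pi j h alpha :
    0 <= h -> 0 < alpha -> (forall b, 0 < rho b) ->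
    discrete_coupling rho0 rho pi ->
    (forall b c, 0 <= j b c) -> (forall b, outflow j b <= rho b) ->
    (forall b c i, j b c != 0 -> `|x i b - x i c| <= h) ->
  exists2 pi', discrete_coupling rho0 (fun c => rho c - outflow j c + inflow j c) pi'
    & forall i, coord_cost pi' i <= (1 + alpha) * coord_cost pi i
      + h ^+ 2 * \sum_b outflow j b
      + alpha^-1 * (h ^+ 2 * \sum_b outflow j b ^+ 2 / rho b).
Proof.
move=> h0 alpha0 rho_gt0 [pi0 pirow picol] j0 jrho jh.
have rho_neq0 b : rho b != 0 by rewrite gt_eqF.
pose F b c := j b c + (b == c)%:R * (rho b - outflow j b).
have F0 b c : 0 <= F b c by rewrite addr_ge0// mulr_ge0// subr_ge0.
have diagE (u : S -> R) b : \sum_c (b == c)%:R * u c = u b.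
  rewrite (bigD1 b)//= eqxx mul1r big1 ?addr0// => c cb.
  by rewrite eq_sym (negbTE cb) mul0r.
have Frow b : \sum_c F b c = rho b.
  by rewrite big_split/= -/(outflow j b) (diagE (fun=> _)) addrC subrK.
exists (fun a c => \sum_b pi a b / rho b * F b c).
  split=> [a c|a|c].
  - by apply: sumr_ge0 => b _; rewrite mulr_ge0// divr_ge0// ltW.
  - rewrite exchange_big/= -pirow; apply: eq_bigr => b _.
    by rewrite -mulr_sumr Frow divfK.
  - rewrite exchange_big/= (eq_bigr (fun b => F b c)); last first.
      by move=> b _; rewrite -mulr_suml -mulr_suml picol divff ?mul1r.
    rewrite big_split/= addrC -/(inflow j c); congr (_ + _).
    rewrite (eq_bigr (fun b => (c == b)%:R * (rho b - outflow j b))) ?diagE//.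
    by move=> b _; rewrite eq_sym.
move=> i; rewrite /coord_cost.
have costF a b : \sum_c F b c * (x i a - x i c) ^+ 2 <=
    (1 + alpha) * rho b * (x i a - x i b) ^+ 2 + h ^+ 2 * outflow j b
    + alpha^-1 * (h ^+ 2 * outflow j b ^+ 2 / rho b).
  have -> : \sum_c F b c * (x i a - x i c) ^+ 2 =
      rho b * (x i a - x i b) ^+ 2
      + 2 * (x i a - x i b) * (\sum_c j b c * (x i b - x i c))
      + \sum_c j b c * (x i b - x i c) ^+ 2.
    transitivity (\sum_c (F b c * (x i a - x i b) ^+ 2
       + (2 * (x i a - x i b) * (j b c * (x i b - x i c))
       + j b c * (x i b - x i c) ^+ 2))); last first.
      by rewrite !big_split/= -mulr_suml -mulr_sumr Frow addrA.
    apply: eq_bigr => c _; rewrite /F; have [<-|bc] := eqVneq b c; rewrite ?mulr1n ?mulr0n; ring.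
  have m1 : `|\sum_c j b c * (x i b - x i c)| <= h * outflow j b.
    rewrite (le_trans (ler_norm_sum _ _ _))// mulr_sumr ler_sum// => c _.
    rewrite normrM (ger0_norm (j0 _ _)) mulrC.
    have [->|jbc] := eqVneq (j b c) 0; first by rewrite !mulr0.
    by rewrite ler_wpM2r// jh.
  have v1 : \sum_c j b c * (x i b - x i c) ^+ 2 <= h ^+ 2 * outflow j b.
    rewrite mulr_sumr ler_sum// => c _; rewrite mulrC.
    have [->|jbc] := eqVneq (j b c) 0; first by rewrite !mulr0.
    by rewrite ler_wpM2r// -real_normK ?num_real// lerXn2r ?nnegrE// jh.
  set d := x i a - x i b; set m := \sum_c j b c * (x i b - x i c) in m1 *.
  set o := outflow j b in m1 v1 *.
  (* AM-GM: [2 d m <= alpha rho d^2 + m^2 / (alpha rho)] *)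
  have amgm : 2 * d * m <=
      alpha * rho b * d ^+ 2 + alpha^-1 * (h ^+ 2 * o ^+ 2 / rho b).
    have m2 : m ^+ 2 <= h ^+ 2 * o ^+ 2.
      rewrite -exprMn -[leLHS]real_normK ?num_real// lerXn2r ?nnegrE//.
      by rewrite (le_trans _ m1).
    apply: (@le_trans _ _ (alpha * rho b * d ^+ 2 + alpha^-1 * (m ^+ 2 / rho b))).
      have ar : 0 < alpha * rho b by rewrite mulr_gt0.
      rewrite -subr_ge0.
      have -> : alpha * rho b * d ^+ 2 + alpha^-1 * (m ^+ 2 / rho b) - 2 * d * m
          = (alpha * rho b * d - m) ^+ 2 / (alpha * rho b).
        by field; rewrite rho_neq0 gt_eqF.
      by rewrite divr_ge0 ?sqr_ge0 ?ltW.
    by rewrite lerD2l ler_pM2l ?invr_gt0// ler_pM2r ?invr_gt0.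
  rewrite (_ : (1 + alpha) * rho b * d ^+ 2 =
    rho b * d ^+ 2 + alpha * rho b * d ^+ 2); last by ring.
  by lra.
apply: (@le_trans _ _ (\sum_a \sum_b pi a b / rho b *
   ((1 + alpha) * rho b * (x i a - x i b) ^+ 2 + h ^+ 2 * outflow j b
    + alpha^-1 * (h ^+ 2 * outflow j b ^+ 2 / rho b)))).
  apply: ler_sum => a _.
  rewrite (eq_bigr (fun c => \sum_b pi a b / rho b * (F b c * (x i a - x i c) ^+ 2)));
    last by move=> c _; rewrite mulr_suml; apply: eq_bigr => b _; rewrite mulrA.
  rewrite exchange_big/=; apply: ler_sum => b _; rewrite -mulr_sumr.
  by rewrite ler_wpM2l// divr_ge0// ltW.
rewrite le_eqVlt; apply/orP; left; apply/eqP.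
transitivity (\sum_a \sum_b ((1 + alpha) * (pi a b * (x i a - x i b) ^+ 2)
   + (h ^+ 2 * (pi a b / rho b * outflow j b)
    + alpha^-1 * (h ^+ 2 * (pi a b / rho b * (outflow j b ^+ 2 / rho b)))))).
  by apply: eq_bigr => a _; apply: eq_bigr => b _; field; rewrite rho_neq0 gt_eqF.
under eq_bigr do rewrite !big_split/=.
rewrite !big_split/= -addrA; congr (_ + (_ + _)).
- by rewrite mulr_sumr; apply: eq_bigr => a _; rewrite mulr_sumr.
- rewrite exchange_big/= mulr_sumr; apply: eq_bigr => b _.
  by rewrite -mulr_sumr -mulr_suml -mulr_suml picol divff ?mul1r.
- rewrite exchange_big/= mulr_sumr mulr_sumr; apply: eq_bigr => b _.
  by rewrite -mulr_sumr -mulr_sumr -mulr_suml -mulr_suml picol divff ?mul1r.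
Qed.

End discrete_transport.
Section discrete_transport_cost.
Context {R : realType} {S I : finType} (x : I -> S -> R).

Lemma expr_le_eventually (q e : R) : 0 <= q < 1 -> 0 < e -> exists n, q ^+ n <= e.
Proof.
move=> /andP[q0 q1] e0.
have /cvg_expr : `|q| < 1 by rewrite ger0_norm.
move=> /cvgrPdist_le /(_ _ e0)[n _ /(_ _ (leqnn n))] /=.
by rewrite sub0r normrN ger0_norm ?exprn_ge0//; exists n.
Qed.

(* Relative to the mass [rho0] still in place, every step moves the same
   fraction: after [s] steps the law is [u^2 rho0 + (1 - u^2) rho1], [u = r^s].
   The bound [20 K^2 (1 - u) + K^2 (1 - u^2)] on the cost telescopes, and what is
   left of [rho0] after many steps is moved at once. *)
Lemma discrete_coupling_flow (rho0 rho1 : S -> R) (j : S -> S -> R) h K :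
    0 <= h -> 0 < K -> (forall b, 0 < rho0 b) -> (forall b, 0 <= rho1 b) ->
    \sum_b rho1 b = 1 ->
    (forall b c, 0 <= j b c) ->
    (forall b, outflow j b - inflow j b = rho0 b - rho1 b) ->
    (forall b c i, j b c != 0 -> `|x i b - x i c| <= h) ->
    h ^+ 2 * (\sum_b outflow j b ^+ 2 / rho0 b) <= K ^+ 2 ->
    h ^+ 2 * (\sum_b outflow j b) <= K ^+ 2 ->
  exists2 pi, discrete_coupling rho0 rho1 pi &
    forall i, coord_cost x pi i <= 52 * K ^+ 2.
Proof.
move=> h0 K0 rho0_gt0 rho1_ge0 rho1_1 j0 divj jh hO hout.
have out0 b : 0 <= outflow j b by exact: sumr_ge0.
have rho0_1 : \sum_b rho0 b = 1.
  rewrite -rho1_1; apply/eqP; rewrite -subr_eq0 -sumrB.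
  under eq_bigr do rewrite -divj.
  by rewrite sumrB /outflow /inflow [X in X - _]exchange_big subrr.
have K20 : 0 < K ^+ 2 by rewrite exprn_gt0.
pose A := \sum_b outflow j b / rho0 b.
have A0 : 0 <= A by apply: sumr_ge0 => b _; rewrite divr_ge0// ltW.
(* As [A] dominates every ratio [outflow j b / rho0 b], this fraction is small enough that no step
   moves more than the part of [rho0] still in place. *)
pose e := (2 * (1 + A))^-1.
have e0 : 0 < e by rewrite invr_gt0; lra.
have e1 : e <= 1 / 2.
  by rewrite /e div1r lef_pV2 ?posrE; lra.
have eout b : 2 * e * outflow j b <= rho0 b.
  have -> : 2 * e = (1 + A)^-1 by rewrite /e invfM mulrA divff ?mul1r.
  rewrite mulrC ler_pdivrMr; last lra.
  rewrite mulrC -ler_pdivrMr// (@le_trans _ _ A) ?lerDr//.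
  rewrite /A (bigD1 b)//= lerDl sumr_ge0// => c _.
  by rewrite divr_ge0// ltW.
pose r := 1 - e.
have rhob u b : 0 < u <= 1 -> u ^+ 2 * rho0 b <= u ^+ 2 * rho0 b + (1 - u ^+ 2) * rho1 b.
  move=> /andP[u0 u1]; rewrite lerDl mulr_ge0// subr_ge0 exprn_ile1//.
  exact: ltW.
have rhob_gt0 u b : 0 < u <= 1 -> 0 < u ^+ 2 * rho0 b + (1 - u ^+ 2) * rho1 b.
  move=> u01; apply: lt_le_trans (rhob _ b u01).
  by rewrite mulr_gt0// exprn_gt0//; case/andP: u01.
have rs01 s : 0 < r ^+ s <= 1.
  by rewrite exprn_gt0 ?exprn_ile1// /r; lra.
have iter s : exists2 pi,
    discrete_coupling rho0 (fun b => (r ^+ s) ^+ 2 * rho0 b + (1 - (r ^+ s) ^+ 2) * rho1 b) pi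
  & forall i, coord_cost x pi i <=
      20 * K ^+ 2 * (1 - r ^+ s) + K ^+ 2 * (1 - (r ^+ s) ^+ 2).
  elim: s => [|s [pi pic cpi]].
    exists (fun a b => (a == b)%:R * rho0 b).
      split=> [a b|a|b]; first by rewrite mulr_ge0// ltW.
      - rewrite (bigD1 a)//= eqxx mul1r big1 ?addr0// => c cb.
        by rewrite eq_sym (negbTE cb) mul0r.
      - rewrite (bigD1 b)//= eqxx mul1r big1 => [|c cb].
          by rewrite expr0; ring.
        by rewrite (negbTE cb) mul0r.
    move=> i; rewrite /coord_cost big1 => [|a _].
      by rewrite expr0 expr1n subrr !mulr0 addr0.
    rewrite big1// => b _; have [->|ab] := eqVneq a b.
      by rewrite subrr expr0n mulr0.
    by rewrite !mul0r.
  set u := r ^+ s in pic cpi.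
  have /andP[u0 u1] := rs01 s; rewrite -/u in u0 u1.
  have u20 : 0 < u ^+ 2 by rewrite exprn_gt0.
  (* [k] is the decrease of [u ^+ 2] in one step; running [k * j] thus gives the interpolated law
     with [u] replaced by [r * u]. *)
  pose k := u ^+ 2 * (1 - r ^+ 2).
  have kE : k = u ^+ 2 * (e * (2 - e)) by rewrite /k /r; ring.
  have e2 : 0 <= e * (2 - e) by rewrite mulr_ge0//; lra.
  have k0 : 0 <= k by rewrite kE mulr_ge0// ltW.
  pose js b c := k * j b c.
  have outs b : outflow js b = k * outflow j b by rewrite /outflow mulr_sumr.
  have ins b : inflow js b = k * inflow j b by rewrite /inflow mulr_sumr.
  (* This is the weight [alpha] of the step. The cost so far is at most [25 * K ^+ 2], so the
     relative increase costs at most [10 * K ^+ 2 * (u * e)], and so does the term in [alpha^-1].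
     Their sum is the decrease of [20 * K ^+ 2 * u], hence the sum over all steps telescopes. *)
  have a0 : 0 < 2 / 5 * u * e by rewrite mulr_gt0// mulr_gt0//; lra.
  have [|||pi' pi'c cpi'] :=
      discrete_coupling_step h0 a0 (fun b => rhob_gt0 u b (rs01 s)) pic (x := x) (j := js).
  - by move=> b c; rewrite mulr_ge0.
  - move=> b; rewrite outs; apply: le_trans (rhob u b (rs01 s)).
    rewrite kE -mulrA ler_pM2l//; apply: le_trans (eout b).
    by rewrite ler_wpM2r// mulrC ler_wpM2r ?ltW//; lra.
  - move=> b c i jbc; apply: jh; apply: contraNN jbc => /eqP jbc.
    by rewrite /js jbc mulr0.
  exists pi'.
    suff -> : (fun b => (r ^+ s.+1) ^+ 2 * rho0 b + (1 - (r ^+ s.+1) ^+ 2) * rho1 b) =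
      (fun b => u ^+ 2 * rho0 b + (1 - u ^+ 2) * rho1 b - outflow js b + inflow js b) by [].
    apply/funext => b; rewrite outs ins (exprSr r s) -/u.
    have -> : inflow j b = outflow j b - (rho0 b - rho1 b) by rewrite -divj; ring.
    by rewrite /k; ring.
  move=> i; apply: (le_trans (cpi' i)).
  have c1 := cpi i; set c := coord_cost x pi i in c1 *.
  have o1 : h ^+ 2 * (\sum_b outflow js b) <= k * K ^+ 2.
    under eq_bigr do rewrite outs.
    by rewrite -mulr_sumr mulrCA ler_wpM2l.
  have o2 : (2 / 5 * u * e)^-1 * (h ^+ 2 * (\sum_b outflow js b ^+ 2 /
      (u ^+ 2 * rho0 b + (1 - u ^+ 2) * rho1 b))) <= 10 * K ^+ 2 * (u * e).
    apply: (@le_trans _ _ ((2 / 5 * u * e)^-1 * (k ^+ 2 / u ^+ 2 * K ^+ 2))).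
      rewrite ler_pM2l ?invr_gt0//.
      apply: (@le_trans _ _ (k ^+ 2 / u ^+ 2 *
          (h ^+ 2 * (\sum_b outflow j b ^+ 2 / rho0 b)))); last first.
        by rewrite ler_wpM2l// divr_ge0 ?sqr_ge0.
      rewrite mulrCA ler_wpM2l ?sqr_ge0// mulr_sumr ler_sum// => b _.
      rewrite outs exprMn.
      have -> : k ^+ 2 / u ^+ 2 * (outflow j b ^+ 2 / rho0 b) =
          k ^+ 2 * outflow j b ^+ 2 * (u ^+ 2 * rho0 b)^-1.
        by field; rewrite !gt_eqF.
      apply: ler_wpM2l; first (by rewrite mulr_ge0 ?sqr_ge0); rewrite lef_pV2 ?posrE//.
      - exact: rhob (rs01 s).
      - exact: rhob_gt0 (rs01 s).
      - by rewrite mulr_gt0.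
    have -> : (2 / 5 * u * e)^-1 * (k ^+ 2 / u ^+ 2 * K ^+ 2) =
        5 / 2 * (2 - e) ^+ 2 * (K ^+ 2 * (u * e)).
      by rewrite kE; field; rewrite !gt_eqF.
    rewrite -[leRHS]mulrA ler_wpM2r ?mulr_ge0 ?ltW//.
    by nra.
  have c2 : 2 / 5 * u * e * c <= 10 * K ^+ 2 * (u * e).
    have -> : 10 * K ^+ 2 * (u * e) = 2 / 5 * u * e * (25 * K ^+ 2) by field.
    rewrite ler_pM2l//; apply: (le_trans c1).
    have : K ^+ 2 * u >= 0 by rewrite mulr_ge0 ?ltW.
    have : K ^+ 2 * u ^+ 2 >= 0 by rewrite mulr_ge0 ?ltW.
    by lra.
  have rE : r ^+ s.+1 = u - u * e by rewrite (exprSr r s) -/u /r; ring.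
  have r2E : (r ^+ s.+1) ^+ 2 = u ^+ 2 - k by rewrite (exprSr r s) -/u /k; ring.
  rewrite r2E rE.
  have -> : 20 * K ^+ 2 * (1 - (u - u * e)) = 20 * K ^+ 2 * (1 - u) + 20 * K ^+ 2 * (u * e).
    by ring.
  have -> : K ^+ 2 * (1 - (u ^+ 2 - k)) = K ^+ 2 * (1 - u ^+ 2) + k * K ^+ 2 by ring.
  rewrite mulrDl mul1r; lra.
(* A crude bound on all displacements suffices for the last step, since [n] is chosen after [D],
   with [u ^+ 2 * D ^+ 2 <= K ^+ 2]. *)
pose D := 1 + \sum_i \sum_a \sum_b `|x i a - x i b|.
have xD i a b : `|x i a - x i b| <= D.
  rewrite /D (bigD1 i)//=; apply: ler_wpDl => //; apply: ler_wpDr.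
    by apply: sumr_ge0 => ? _; apply: sumr_ge0 => ? _; exact: sumr_ge0.
  rewrite (bigD1 a)//=; apply: ler_wpDr.
    by apply: sumr_ge0 => ? _; exact: sumr_ge0.
  by rewrite (bigD1 b)//=; apply: ler_wpDr => //; exact: sumr_ge0.
have D0 : 0 < D.
  by rewrite ltr_pwDl// sumr_ge0// => i _; rewrite sumr_ge0// => a _; rewrite sumr_ge0.
have D20 : 0 < D ^+ 2 by rewrite exprn_gt0.
have [n un] : exists n, r ^+ n <= K ^+ 2 / D ^+ 2.
  by apply: expr_le_eventually; [rewrite /r; lra|rewrite divr_gt0].
have [pi pic cpi] := iter n.
have /andP[u0 u1] := rs01 n; have ru := rhob_gt0 _ _ (rs01 n).
have rru := rhob _ _ (rs01 n).
set u := r ^+ n in u0 u1 pic cpi un ru rru.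
have u20 : 0 < u ^+ 2 by rewrite exprn_gt0.
have uD : u ^+ 2 * D ^+ 2 <= K ^+ 2.
  rewrite -ler_pdivlMr// (le_trans _ un)//.
  by rewrite expr2 -[leRHS]mulr1 ler_pM2l.
(* All that is left of [rho0] is redistributed according to [rho1]. With [alpha = 1] the final cost
   is at most twice [21 * K ^+ 2] plus [2 * K ^+ 2], which is below [52 * K ^+ 2]. *)
pose jn b c := u ^+ 2 * rho0 b * rho1 c.
have outn b : outflow jn b = u ^+ 2 * rho0 b.
  by rewrite /outflow -mulr_sumr rho1_1 mulr1.
have inn b : inflow jn b = u ^+ 2 * rho1 b.
  by rewrite /inflow -mulr_suml -mulr_sumr rho0_1 mulr1.
have [|||pi' pi'c cpi'] := discrete_coupling_step (ltW D0) ltr01 ru pic (x := x) (j := jn).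
- by move=> b c; rewrite mulr_ge0// mulr_ge0 ?ltW.
- by move=> b; rewrite outn.
- by move=> b c i _; exact: xD.
exists pi'.
  suff -> : rho1 = (fun b => u ^+ 2 * rho0 b + (1 - u ^+ 2) * rho1 b
    - outflow jn b + inflow jn b) by [].
  by apply/funext => b; rewrite outn inn; ring.
move=> i; apply: (le_trans (cpi' i)).
have c1 := cpi i; set c := coord_cost x pi i in c1 *.
have o1 : D ^+ 2 * (\sum_b outflow jn b) <= K ^+ 2.
  under eq_bigr do rewrite outn.
  by rewrite -mulr_sumr rho0_1 mulr1 mulrC.
have o2 : D ^+ 2 * (\sum_b outflow jn b ^+ 2 /
    (u ^+ 2 * rho0 b + (1 - u ^+ 2) * rho1 b)) <= K ^+ 2.
  apply: le_trans o1; rewrite ler_pM2l// ler_sum// => b _.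
  rewrite outn ler_pdivrMr// expr2 ler_pM2l//.
  by rewrite mulr_gt0.
rewrite invr1 mul1r.
have : K ^+ 2 * u >= 0 by rewrite mulr_ge0 ?ltW.
have : K ^+ 2 * u ^+ 2 >= 0 by rewrite mulr_ge0 ?ltW.
lra.
Qed.

End discrete_transport_cost.

(** * The dyadic flow on a grid *)

Section dyadic_kernel.
Context {R : realType}.

Definition same_block k (s y : nat) : bool := (s %/ 2 ^ k == y %/ 2 ^ k)%N.

Definition block_avg k (s y : nat) : R := (same_block k s y)%:R / 2 ^+ k.

Lemma same_block_leq k l s y : (k <= l)%N -> same_block k s y -> same_block l s y.
Proof.
move=> kl /eqP sy; apply/eqP.
by rewrite -(subnK kl) expnD mulnC !divnMA sy.
Qed.

Lemma count_block (p q n : nat) : (0 < p)%N ->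
  (\sum_(s < n) (s %/ p == q) = minn p (n - q * p))%N.
Proof.
move=> p0; elim: n => [|n IH]; first by rewrite big_ord0 sub0n minn0.
rewrite big_ord_recr/= IH.
have [<-|nq] := eqVneq (n %/ p)%N q.
  have := ltn_pmod n p0; have := divn_eq n p; lia.
rewrite addn0; have [nlt|nge] := ltnP n (q * p)%N; first by lia.
have : (q < n %/ p)%N by rewrite ltn_neqAle eq_sym nq leq_divRL.
rewrite leq_divRL// mulSn; lia.
Qed.

Definition cum_avg k (n y : nat) : R := \sum_(s < n) block_avg k s y.

Lemma cum_avgE k n y :
  cum_avg k n y = (minn (2 ^ k) (n - y %/ 2 ^ k * 2 ^ k))%:R / 2 ^+ k.
Proof.
by rewrite /cum_avg -mulr_suml -count_block ?expn_gt0// natr_sum.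
Qed.

Lemma cum_avg_itv k n y : 0 <= cum_avg k n y <= 1.
Proof.
rewrite cum_avgE divr_ge0 ?exprn_ge0//= ler_pdivrMr ?exprn_gt0//.
by rewrite mul1r -natrX ler_nat geq_minl.
Qed.

Lemma cum_avg0 k n y : (n <= y %/ 2 ^ k * 2 ^ k)%N -> cum_avg k n y = 0.
Proof. by rewrite cum_avgE -subn_eq0 => /eqP ->; rewrite minn0 mul0r. Qed.

Lemma cum_avg1 k n y : ((y %/ 2 ^ k).+1 * 2 ^ k <= n)%N -> cum_avg k n y = 1.
Proof.
rewrite cum_avgE mulSn => n1.
by rewrite (minn_idPl _) ?natrX ?divff ?expf_neq0// leq_subRL; lia.
Qed.

(** By conservation of mass on a line, the flux to the right across the face before [n] is the mass
    on its left before the averaging minus the mass there afterwards. *)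
Definition cum_diff k n y : R := cum_avg k n y - cum_avg k.+1 n y.

(** Averaging from scale [k] to scale [k.+1] only moves mass inside one block of length [2 ^ k.+1].
    To the left of this block both cumulative masses are 0, to its right both are 1; the condition
    on [n] says that it is one of the two faces of [s]. *)
Lemma cum_diff_outside k n (s y : nat) : (s <= n <= s.+1)%N ->
  ~~ same_block k.+1 s y -> cum_diff k n y = 0.
Proof.
move=> /andP[sn ns]; rewrite /same_block /cum_diff neq_ltn.
have p0 : (0 < 2 ^ k)%N by rewrite expn_gt0.
have p1 : (0 < 2 ^ k.+1)%N by rewrite expn_gt0.
have yk : (y %/ 2 ^ k.+1 = y %/ 2 ^ k %/ 2)%N by rewrite expnSr divnMA.
have pk : (2 ^ k.+1 = 2 * 2 ^ k)%N by rewrite expnS.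
move=> /orP[h|h].
  have h1 : (n <= y %/ 2 ^ k.+1 * 2 ^ k.+1)%N.
    by apply: (leq_trans ns); rewrite ltnNge -leq_divRL// -ltnNge.
  rewrite !cum_avg0 ?subrr//; apply: (leq_trans h1).
  by rewrite yk pk mulnA leq_mul2r leq_divM orbT.
have h1 : ((y %/ 2 ^ k.+1).+1 * 2 ^ k.+1 <= n)%N.
  by apply: leq_trans sn; rewrite -leq_divRL.
rewrite !cum_avg1 ?subrr//; apply: leq_trans h1.
rewrite yk pk mulnA leq_mul2r; apply/orP; right.
by have := ltn_ceil (y %/ 2 ^ k) (isT : (0 < 2)%N); lia.
Qed.

Lemma cum_diff_bound k n y : `|cum_diff k n y| <= 1.
Proof.
have /andP[a0 a1] := cum_avg_itv k n y.
have /andP[b0 b1] := cum_avg_itv k.+1 n y.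
by rewrite /cum_diff ler_norml; lra.
Qed.

(* The sum is dominated by its first nonzero term. *)
Lemma sqr_sum_geometric_tail (q : R) (I : nat -> bool) K : 0 <= q <= 1 / 2 ->
  (forall k, I k -> I k.+1) ->
  (\sum_(k < K) q ^+ k * (I k)%:R) ^+ 2 <= 4 * \sum_(k < K) q ^+ k ^+ 2 * (I k)%:R.
Proof.
move=> /andP[q0 q1]; elim: K I => [|K IH] I IS.
  by rewrite !big_ord0 expr0n mulr0.
rewrite !big_ord_recl !expr0 expr1n !mul1r.
have E1 : \sum_(i < K) q ^+ lift ord0 i * (I (lift ord0 i))%:R =
    q * \sum_(i < K) q ^+ i * (I i.+1)%:R.
  by rewrite mulr_sumr; apply: eq_bigr => i _; rewrite lift0 exprS mulrA.
have E2 : \sum_(i < K) q ^+ lift ord0 i ^+ 2 * (I (lift ord0 i))%:R =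
    q ^+ 2 * \sum_(i < K) q ^+ i ^+ 2 * (I i.+1)%:R.
  by rewrite mulr_sumr; apply: eq_bigr => i _; rewrite lift0 (exprS q i) exprMn mulrA.
rewrite E1 E2.
have [I0|_] := boolP (I 0%N); last first.
  rewrite !mulr0n !add0r exprMn [leRHS]mulrCA ler_wpM2l ?sqr_ge0//.
  by rewrite (IH (fun k => I k.+1))// => k /IS.
have s0 : 0 <= \sum_(i < K) q ^+ i * (I i.+1)%:R.
  by apply: sumr_ge0 => i _; rewrite mulr_ge0 ?exprn_ge0.
have s1 : \sum_(i < K) q ^+ i * (I i.+1)%:R <= 2.
  apply: (@le_trans _ _ (\sum_(i < K) q ^+ i)).
    by apply: ler_sum => i _; rewrite ler_piMr ?exprn_ge0// lern1 leq_b1.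
  have : (1 - q) * (\sum_(i < K) q ^+ i) <= 1.
    have -> : (1 - q) * (\sum_(i < K) q ^+ i) = 1 - q ^+ K.
      by rewrite -opprB mulNr -subrX1 opprB.
    by rewrite lerBlDr lerDl exprn_ge0.
  have : 0 <= \sum_(i < K) q ^+ i by apply: sumr_ge0 => i _; rewrite exprn_ge0.
  by nra.
have t0 : 0 <= \sum_(i < K) q ^+ i ^+ 2 * (I i.+1)%:R.
  by apply: sumr_ge0 => i _; rewrite mulr_ge0 ?sqr_ge0.
rewrite mulr1n.
set u := \sum_(i < K) _ in s0 s1 *; set t := \sum_(i < K) _ in t0 *.
have q2t : 0 <= q ^+ 2 * t by rewrite mulr_ge0 ?sqr_ge0.
have qu0 : 0 <= q * u by rewrite mulr_ge0.
have qu1 : q * u <= 1 by nra.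
by nra.
Qed.

End dyadic_kernel.

Section grid_kernel.
Context {R : realType} (d K : nat).
Local Notation S := {ffun 'I_d -> 'I_(2 ^ K)}.

(* [grid_kernel i n b x] is the flux in direction [i], across the face of
   coordinate [n] on the line of [b], of the flow that spreads a unit mass from
   the cell [x] uniformly over the grid: from the dyadic cube of side [2 ^ k]
   around [x] to that of side [2 ^ k.+1], one coordinate after the other. *)
Definition grid_kernel (i : 'I_d) (n : nat) (b x : S) : R :=
  \sum_(k < K) (\prod_(l | l != i) block_avg (k + (l < i)) (b l) (x l))
    * cum_diff k n (x i).

(** Intermediate stages between two scales: the coordinates below [i] are already averaged at scale
    [k.+1], the others still at scale [k]. *)
Let avg k i (b x : S) : R := \prod_(l < d) block_avg (k + (l < i)) (b l) (x l).

Let avg00 b x : avg 0 0 b x = (b == x)%:R.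
Proof.
rewrite /avg; under eq_bigr do rewrite ltn0 /block_avg /same_block expn0 expr0 !divn1 divr1.
have [->|bx] := eqVneq b x; first by rewrite big1// => l _; rewrite eqxx.
have /existsP[l bl] : [exists l, b l != x l].
  apply: contra_neqT bx => /existsPn bx; apply/ffunP => l.
  by have := bx l; rewrite negbK => /eqP.
by rewrite (bigD1 l)//= (_ : (_ == _)%N = false) ?mul0r//; exact/negbTE.
Qed.

Let avgK b x : avg K 0 b x = (2 ^+ K)^-1 ^+ d.
Proof.
rewrite /avg (eq_bigr (fun=> (2 ^+ K)^-1)) ?prodr_const ?card_ord// => l _.
by rewrite ltn0 addn0 /block_avg /same_block !divn_small// eqxx mul1r.
Qed.

(** The divergence telescopes twice, over the coordinates within a scale and then over the scales,
    from the point mass [avg 0 0] to the uniform law [avg K 0]. *)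
Lemma grid_kernelB (b x : S) :
  \sum_i (grid_kernel i (b i).+1 b x - grid_kernel i (b i) b x) =
  (b == x)%:R - (2 ^+ K)^-1 ^+ d.
Proof.
rewrite -avg00 -(avgK b x).
have -> : avg 0 0 b x - avg K 0 b x = \sum_(k < K) (avg k 0 b x - avg k.+1 0 b x).
  rewrite -(big_mkord xpredT (fun k => avg k 0 b x - avg k.+1 0 b x)).
  by under eq_bigr do rewrite -opprB; rewrite sumrN telescope_sumr// opprB.
have avgd k : avg k.+1 0 b x = avg k d b x.
  by apply: eq_bigr => l _; rewrite ltn0 addn0 ltn_ord addn1.
transitivity (\sum_(k < K) \sum_(i < d) (avg k i b x - avg k i.+1 b x)); last first.
  apply: eq_bigr => k _; rewrite avgd.
  rewrite -(big_mkord xpredT (fun i => avg k i b x - avg k i.+1 b x)).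
  by under eq_bigr do rewrite -opprB; rewrite sumrN telescope_sumr// opprB.
rewrite exchange_big/=; apply: eq_bigr => i _.
rewrite -sumrB; apply: eq_bigr => k _.
rewrite -mulrBr {1 2}/avg [in RHS](bigD1 i)//= [X in _ = _ - X](bigD1 i)//=.
have -> : \prod_(l < d | l != i) block_avg (k + (l < i.+1)) (b l) (x l) =
    \prod_(l < d | l != i) block_avg (k + (l < i)) (b l) (x l) :> R.
  by apply: eq_bigr => l li; rewrite ltnS leq_eqVlt (inj_eq val_inj) (negbTE li).
rewrite -mulrBl mulrC ltnn ltnSn addn0 addn1; congr (_ * _).
by rewrite /cum_diff /cum_avg !big_ord_recr/=; ring.
Qed.

Lemma grid_kernel_first i b x : grid_kernel i 0 b x = 0.
Proof.
rewrite /grid_kernel big1// => k _.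
by rewrite /cum_diff !cum_avg0// subrr mulr0.
Qed.

Lemma grid_kernel_last i b x : grid_kernel i (2 ^ K) b x = 0.
Proof.
rewrite /grid_kernel big1// => k _.
have h l y : (l <= K)%N -> (y < 2 ^ K)%N -> ((y %/ 2 ^ l).+1 * 2 ^ l <= 2 ^ K)%N.
  move=> lK yK; rewrite -[X in (_ <= 2 ^ X)%N](subnK lK) expnD leq_mul2r.
  by apply/orP; right; rewrite ltn_divLR ?expn_gt0// -expnD subnK.
by rewrite /cum_diff !cum_avg1 ?subrr ?mulr0// h// ltnW.
Qed.

Lemma grid_kernel_eq i n (b c x : S) : (forall l, l != i -> b l = c l) ->
  grid_kernel i n b x = grid_kernel i n c x.
Proof.
move=> bc; apply: eq_bigr => k _; congr (_ * _).
by apply: eq_bigr => l li; rewrite bc.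
Qed.

Let near k (b x : S) := [forall l, same_block k.+1 (b l) (x l)].

Let nearS k b x : near k b x -> near k.+1 b x.
Proof.
by move=> /forallP h; apply/forallP => l; exact: same_block_leq (h l).
Qed.

Let card_near k (b : S) : \sum_x (near k b x)%:R <= (2 ^+ k.+1) ^+ d :> R.
Proof.
have -> : \sum_x (near k b x)%:R =
    \sum_(x : S) \prod_l (same_block k.+1 (b l) (x l))%:R :> R.
  apply: eq_bigr => x _; rewrite -natr_prod; congr (_%:R).
  have [/forallP h|] := boolP (near k b x).
    by rewrite big1// => l _; rewrite h.
  move=> /forallPn[l hl]; rewrite (bigD1 l)//= (negbTE hl).
  by rewrite mul0n.
rewrite -(bigA_distr_bigA (fun l (y : 'I_(2 ^ K)) =>
   (same_block k.+1 (b l) y)%:R : R))/=.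
rewrite -[in leRHS](card_ord d) -prodr_const.
apply: ler_prod => l _; rewrite sumr_ge0//= -natr_sum -natrX ler_nat.
rewrite (eq_bigr (fun y : 'I_(2 ^ K) => ((y %/ 2 ^ k.+1 == b l %/ 2 ^ k.+1)%N : nat))).
  by rewrite count_block ?expn_gt0// geq_minl.
by move=> y _; rewrite /same_block eq_sym.
Qed.

(** The term of scale [k] vanishes unless [b] and [x] share a dyadic cube of side [2 ^ k.+1]. There,
    each of the [d.-1] transversal averages is at most [2 ^- k] and the cumulative difference is at
    most 1. *)
Lemma grid_kernel_bound i n (b x : S) : (b i <= n <= (b i).+1)%N ->
  `|grid_kernel i n b x| <= \sum_(k < K) ((2 ^+ d.-1)^-1) ^+ k * (near k b x)%:R.
Proof.
move=> bn; apply: (le_trans (ler_norm_sum _ _ _)); apply: ler_sum => k _.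
rewrite normrM.
have [nb|] := boolP (near k b x); last first.
  move=> /forallPn[l nl]; rewrite mulr0.
  have [li|li] := eqVneq l i.
    by rewrite (cum_diff_outside (y := x i) bn) ?normr0 ?mulr0// -li.
  rewrite (bigD1 l)//= {1}/block_avg (_ : same_block _ _ _ = false) ?mul0r ?normr0 ?mul0r//.
  apply/negbTE; apply: contra nl; apply: same_block_leq.
  by rewrite -[X in (_ <= X)%N]addn1 leq_add2l leq_b1.
rewrite mulr1n; apply: ler_pM => //; last exact: cum_diff_bound.
rewrite normr_prod.
have -> : (2 ^+ d.-1)^-1 ^+ k = \prod_(l : 'I_d | l != i) (2 ^+ k)^-1 :> R.
  rewrite prodr_const -!exprVn -!exprM.
  have -> : #|[pred l | l != i]| = d.-1 by rewrite cardC1 card_ord.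
  by rewrite mulnC.
apply: ler_prod => l li; rewrite normr_ge0/= /block_avg normrM normfV.
rewrite !ger0_norm ?exprn_ge0// -[leRHS]mul1r ler_pM ?invr_ge0 ?exprn_ge0//.
  by rewrite lern1 leq_b1.
by rewrite lef_pV2 ?posrE ?exprn_gt0// ler_weXn2l ?ler1n// leq_addr.
Qed.

(** Cauchy-Schwarz over the scales would lose a factor [K]. Since [near k] is increasing in [k] and
    the weights decay geometrically, [sqr_sum_geometric_tail] loses only the factor 4. The cube at
    scale [k] contains at most [2 ^ (k.+1 * d)] cells, each with squared weight
    [2 ^- (2 * d.-1 * k)]. *)
Lemma sum_sqr_grid_kernel i n (b : S) : (1 < d)%N -> (b i <= n <= (b i).+1)%N ->
  \sum_x grid_kernel i n b x ^+ 2 <= 4 * 2 ^+ d * \sum_(k < K) (4 / 2 ^+ d) ^+ k.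
Proof.
move=> d1 bn.
have q01 : (0 : R) <= ((2 : R) ^+ d.-1)^-1 <= 1 / 2.
  rewrite invr_ge0 exprn_ge0//= div1r lef_pV2 ?posrE ?exprn_gt0//.
  rewrite -[leLHS]expr1 ler_weXn2l ?ler1n//; lia.
apply: (@le_trans _ _ (\sum_x 4 * \sum_(k < K) (2 ^+ d.-1)^-1 ^+ k ^+ 2 * (near k b x)%:R)).
  apply: ler_sum => x _.
  apply: le_trans (sqr_sum_geometric_tail _ q01 (fun k => @nearS k b x)).
  rewrite -[leLHS]real_normK ?num_real// lerXn2r ?nnegrE//.
    by apply: sumr_ge0 => k _; rewrite mulr_ge0// exprn_ge0//; case/andP: q01.
  exact: grid_kernel_bound.
rewrite -mulr_sumr -mulrA ler_pM2l// exchange_big/= mulr_sumr.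
apply: ler_sum => k _; rewrite -mulr_sumr.
have -> : 2 ^+ d * (4 / 2 ^+ d) ^+ k = (2 ^+ d.-1)^-1 ^+ k ^+ 2 * (2 ^+ k.+1) ^+ d :> R.
  have -> : d = d.-1.+1 by rewrite prednK// ltnW.
  rewrite /=; set e := d.-1.
  have a0 : 2 ^+ k != 0 :> R by rewrite expf_neq0.
  have c0 : (2 ^+ e) ^+ k != 0 :> R by rewrite !expf_neq0.
  have -> : (2 ^+ k.+1) ^+ e.+1 = 2 ^+ e.+1 * (2 ^+ k * (2 ^+ e) ^+ k) :> R.
    by rewrite [2 ^+ k.+1]exprS exprMn [(2 ^+ k) ^+ _]exprS -!exprM [(k * e)%N]mulnC.
  have -> : (4 / 2 ^+ e.+1) ^+ k = (2 ^+ k) ^+ 2 / (2 ^+ k * (2 ^+ e) ^+ k) :> R.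
    rewrite exprMn exprVn; congr (_ / _).
      by rewrite -exprM mulnC exprM; congr (_ ^+ k); ring.
    by rewrite exprS exprMn.
  by rewrite exprVn; field; rewrite a0 c0.
by rewrite ler_wpM2l ?sqr_ge0.
Qed.

End grid_kernel.

Section grid_flow.
Context {R : realType} (d m : nat).
Local Notation S := {ffun 'I_d -> 'I_m}.

Definition next_cell (i : 'I_d) (b c : S) : bool :=
  [forall l, (c l : nat) == (b l + (l == i))%N].

Let sum_next i (b : S) :
  \sum_c (next_cell i b c)%:R = ((b i).+1 < m)%:R :> R.
Proof.
have [bm|bm] := ltnP (b i).+1 m; last first.
  rewrite big1// => c _; rewrite (_ : next_cell _ _ _ = false)//.
  apply/negbTE/forallPn; exists i; rewrite eqxx addn1 neq_ltn.
  by rewrite (leq_trans (ltn_ord _) bm).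
pose c0 : S := [ffun l => insubd (b l) (b l + (l == i))%N].
have c0E l : c0 l = (b l + (l == i))%N :> nat.
  rewrite ffunE val_insubd; case: ifPn => //.
  by have [->|_] := eqVneq l i; rewrite ?addn0 ?ltn_ord// addn1 bm.
rewrite (bigD1 c0)//= big1 => [|c cc0].
  by rewrite addr0 (_ : next_cell _ _ _)//; apply/forallP => l; rewrite c0E.
rewrite (_ : next_cell _ _ _ = false)//; apply: contraNF cc0 => /forallP h.
by apply/eqP/ffunP => l; apply/val_inj; rewrite /= c0E; exact/eqP.
Qed.

Let sum_prev i (b : S) :
  \sum_c (next_cell i c b)%:R = (0 < b i)%:R :> R.
Proof.
have [b0|b0] := posnP (b i).
  rewrite big1// => c _; rewrite (_ : next_cell _ _ _ = false)//.
  by apply/negbTE/forallPn; exists i; rewrite eqxx addn1 b0.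
have bm l : ((b l - (l == i)) < m)%N by rewrite (leq_ltn_trans (leq_subr _ _)).
pose c0 : S := [ffun l => Ordinal (bm l)].
have c0E l : (c0 l + (l == i))%N = b l :> nat.
  rewrite ffunE/= subnK//.
  by have [->|] := eqVneq l i.
rewrite (bigD1 c0)//= big1 => [|c cc0].
  by rewrite addr0 (_ : next_cell _ _ _)//; apply/forallP => l; rewrite c0E.
rewrite (_ : next_cell _ _ _ = false)//; apply: contraNF cc0 => /forallP h.
apply/eqP/ffunP => l; apply/val_inj/eqP; rewrite /= -(eqn_add2r (l == i)) c0E eq_sym.
exact: h.
Qed.

(** Signed fluxes become a nonnegative flow by splitting signs: the positive part of [Jp] leaves
    through the upper face, the negative part of [Jm] through the lower one. The hypotheses say that
    neighbours agree on their common face and that nothing crosses the boundary of the grid. *)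
Lemma grid_flow (Jp Jm : 'I_d -> S -> R) :
    (forall i b c, next_cell i b c -> Jm i c = Jp i b) ->
    (forall i (b : S), b i = 0%N :> nat -> Jm i b = 0) ->
    (forall i (b : S), (b i).+1 = m -> Jp i b = 0) ->
  exists j : S -> S -> R, [/\ forall b c, 0 <= j b c,
    forall b, outflow j b - inflow j b = \sum_i (Jp i b - Jm i b),
    forall b, outflow j b <= \sum_i (`|Jp i b| + `|Jm i b|) &
    forall b c, j b c != 0 -> exists i, next_cell i b c \/ next_cell i c b].
Proof.
move=> JpJm Jm0 Jp0.
pose pos (z : R) := Num.max z 0; pose neg (z : R) := Num.max (- z) 0.
have pos0 z : 0 <= pos z by rewrite /pos le_max lexx orbT.
have neg0 z : 0 <= neg z by rewrite /neg le_max lexx orbT.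
have posB z : pos z - neg z = z.
  by rewrite /pos /neg; case: (leP z 0) => ?; case: (leP (- z) 0) => ?; lra.
have posle z : pos z <= `|z| by rewrite /pos ge_max normr_ge0 ler_norm.
have negle z : neg z <= `|z| by rewrite /neg ge_max normr_ge0 -normrN ler_norm.
have nx0 : pos 0 = 0 /\ neg 0 = 0 by rewrite /pos /neg oppr0 maxxx.
pose j b c := \sum_i ((next_cell i b c)%:R * pos (Jp i b)
                      + (next_cell i c b)%:R * neg (Jm i b)).
have outE b : outflow j b = \sum_i (pos (Jp i b) + neg (Jm i b)).
  rewrite /outflow exchange_big/=; apply: eq_bigr => i _.
  rewrite big_split/= -!mulr_suml sum_next sum_prev; congr (_ + _).
    have [bm|bm] := ltnP (b i).+1 m; first by rewrite mul1r.
    by rewrite Jp0 ?nx0.1 ?mulr0//; apply/eqP; rewrite eqn_leq bm ltn_ord.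
  by have [b0|b0] := posnP (b i); rewrite ?mul1r// Jm0// nx0.2 mulr0.
have inE b : inflow j b = \sum_i (pos (Jm i b) + neg (Jp i b)).
  rewrite /inflow exchange_big/=; apply: eq_bigr => i _.
  rewrite big_split/=; congr (_ + _).
    transitivity (\sum_c (next_cell i c b)%:R * pos (Jm i b)).
      apply: eq_bigr => c _; have [/JpJm->//|_] := boolP (next_cell i c b).
      by rewrite !mul0r.
    rewrite -mulr_suml sum_prev.
    by have [b0|b0] := posnP (b i); rewrite ?mul1r// Jm0// nx0.1 mulr0.
  transitivity (\sum_c (next_cell i b c)%:R * neg (Jp i b)).
    apply: eq_bigr => c _; have [/JpJm->//|_] := boolP (next_cell i b c).
    by rewrite !mul0r.
  rewrite -mulr_suml sum_next.
  have [bm|bm] := ltnP (b i).+1 m; first by rewrite mul1r.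
  by rewrite Jp0 ?nx0.2 ?mulr0//; apply/eqP; rewrite eqn_leq bm ltn_ord.
exists j; split=> [b c|b|b|b c].
- by apply: sumr_ge0 => i _; rewrite addr_ge0 ?mulr_ge0.
- rewrite outE inE -sumrB; apply: eq_bigr => i _.
  by rewrite -[in RHS](posB (Jp i b)) -[in RHS](posB (Jm i b)); ring.
- by rewrite outE; apply: ler_sum => i _; rewrite lerD.
- move=> jbc; apply/not_existsP => nj; move/eqP: jbc; apply.
  rewrite /j big1// => i _; have /not_orP[/negP/negbTE -> /negP/negbTE ->] := nj i.
  by rewrite !mul0r addr0.
Qed.

End grid_flow.

Lemma sqr_sum_le {R : realType} (n : nat) (a : 'I_n -> R) :
  (\sum_i a i) ^+ 2 <= n%:R * \sum_i a i ^+ 2.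
Proof.
have : 0 <= \sum_i \sum_j (a i - a j) ^+ 2.
  by apply: sumr_ge0 => i _; apply: sumr_ge0 => j _; exact: sqr_ge0.
have -> : \sum_i \sum_j (a i - a j) ^+ 2 =
    2 * (n%:R * \sum_i a i ^+ 2) - 2 * (\sum_i a i) ^+ 2.
  transitivity (\sum_i (n%:R * a i ^+ 2 + \sum_j a j ^+ 2 - 2 * a i * \sum_j a j)).
    apply: eq_bigr => i _.
    transitivity (\sum_(j < n) (a i ^+ 2 + a j ^+ 2 - 2 * a i * a j)).
      by apply: eq_bigr => j _; ring.
    by rewrite sumrB big_split/= sumr_const card_ord [n%:R * _]mulr_natl -mulr_sumr.
  rewrite sumrB big_split/= sumr_const card_ord -mulr_sumr -mulr_suml -mulr_sumr.
  by rewrite -(mulr_natl (\sum_j _) n); ring.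
by lra.
Qed.

Section grid_transport.
Context {R : realType} (d K : nat).
Local Notation S := {ffun 'I_d -> 'I_(2 ^ K)}.

Definition face_flux (g : S -> R) (s : bool) (i : 'I_d) (b : S) : R :=
  \sum_x grid_kernel i (b i + s) b x * g x.

(** The flow superposes the kernels with weights [rho0 - rho1]. The factor [2 * d%:R] comes from
    Cauchy-Schwarz over the two faces in each of the [d] directions. *)
Lemma grid_transport (rho0 rho1 : S -> R) (I : finType) (x : I -> S -> R) h k0 :
    0 < h -> 0 < k0 -> (forall b, k0 <= rho0 b) -> (forall b, 0 <= rho1 b) ->
    \sum_b rho0 b = 1 -> \sum_b rho1 b = 1 ->
    (forall i b c l, next_cell i b c -> `|x l b - x l c| <= h) ->
  exists2 pi, discrete_coupling rho0 rho1 pi & forall l, coord_cost x pi l <=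
    52 * (h ^+ 2 * (1 + 2 * d%:R / k0 * \sum_b \sum_i \sum_(s : bool)
       face_flux (fun y => rho0 y - rho1 y) s i b ^+ 2)).
Proof.
move=> h0 k00 rho0k rho1_ge0 rho0_1 rho1_1 xh.
have rho0_gt0 b : 0 < rho0 b by exact: lt_le_trans (rho0k b).
set g := fun y => rho0 y - rho1 y.
have [|||j [j0 jdiv jout jnext]] := @grid_flow R d (2 ^ K)
  (fun i b => face_flux g true i b) (fun i b => face_flux g false i b).
- move=> i b c /forallP bc; apply: eq_bigr => y _; congr (_ * _).
  have -> : (c i + false = b i + true)%N.
    by have /eqP := bc i; rewrite eqxx addn0.
  apply: grid_kernel_eq => l li; apply/val_inj => /=.
  by have /eqP := bc l; rewrite (negbTE li) addn0.
- move=> i b b0; rewrite /face_flux big1// => y _.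
  by rewrite b0 grid_kernel_first mul0r.
- move=> i b bm; rewrite /face_flux big1// => y _.
  by rewrite addn1 bm grid_kernel_last mul0r.
(* Zero total mass removes the uniform term of [grid_kernelB], so the divergence is exactly [g]
   although [rho0] is not uniform. *)
have sg : \sum_y g y = 0 by rewrite sumrB rho0_1 rho1_1 subrr.
have jdivg b : outflow j b - inflow j b = rho0 b - rho1 b.
  rewrite jdiv /face_flux.
  transitivity (\sum_y ((b == y)%:R - (2 ^+ K)^-1 ^+ d) * g y).
    under eq_bigr do rewrite -sumrB.
    rewrite exchange_big/=; apply: eq_bigr => y _.
    rewrite -grid_kernelB mulr_suml; apply: eq_bigr => i _.
    by rewrite addn0 addn1 mulrBl.
  under eq_bigr do rewrite mulrBl.
  rewrite sumrB -mulr_sumr sg mulr0 subr0 (bigD1 b)//= eqxx mul1r.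
  by rewrite big1 ?addr0// => y; rewrite eq_sym => /negbTE ->; rewrite mul0r.
set Q := \sum_b \sum_i \sum_(s : bool) face_flux g s i b ^+ 2.
have Q0 : 0 <= Q.
  do 3 (apply: sumr_ge0 => ? _); exact: sqr_ge0.
have out0 b : 0 <= outflow j b by apply: sumr_ge0.
have o2 : \sum_b outflow j b ^+ 2 / rho0 b <= 2 * d%:R / k0 * Q.
  rewrite mulr_sumr; apply: ler_sum => b _.
  have : outflow j b ^+ 2 <= 2 * d%:R * \sum_i \sum_(s : bool) face_flux g s i b ^+ 2.
    apply: (@le_trans _ _ ((\sum_i (`|face_flux g true i b| + `|face_flux g false i b|)) ^+ 2)).
      rewrite lerXn2r// nnegrE; first exact: out0.
      by apply: sumr_ge0 => i _; exact: addr_ge0.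
    apply: (le_trans (sqr_sum_le _)); rewrite [2 * _]mulrC -mulrA.
    apply: ler_wpM2l; first exact: ler0n.
    rewrite mulr_sumr.
    apply: ler_sum => i _; rewrite big_bool/=.
    rewrite -[X in 2 * (X + _)]real_normK ?num_real// -[X in 2 * (_ + X)]real_normK ?num_real//.
    rewrite -subr_ge0.
    rewrite (_ : _ - _ = (`|face_flux g true i b| - `|face_flux g false i b|) ^+ 2) ?sqr_ge0//.
    by ring.
  move=> ob; rewrite [leRHS]mulrAC; apply: ler_pM => //; first exact: sqr_ge0.
    by rewrite invr_ge0 ltW.
  by rewrite lef_pV2 ?posrE.
(* Pointwise [t <= rho + t ^+ 2 / rho], so the fluctuation cost is controlled by the same quadratic
   quantity as the drift cost. *)
have o1 : \sum_b outflow j b <= 1 + 2 * d%:R / k0 * Q.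
  apply: (@le_trans _ _ (\sum_b (rho0 b + outflow j b ^+ 2 / rho0 b))).
    apply: ler_sum => b _.
    rewrite -subr_ge0.
    have -> : rho0 b + outflow j b ^+ 2 / rho0 b - outflow j b =
       ((outflow j b - rho0 b) ^+ 2 + outflow j b * rho0 b) / rho0 b.
      by field; rewrite gt_eqF.
    by rewrite divr_ge0 ?addr_ge0 ?sqr_ge0 ?mulr_ge0 ?(ltW (rho0_gt0 _)).
  by rewrite big_split/= rho0_1 lerD2l.
set E := h ^+ 2 * _.
have E0 : 0 < E.
  by rewrite mulr_gt0 ?exprn_gt0// ltr_wpDr// mulr_ge0// divr_ge0 ?(ltW k00)// mulr_ge0.
have sE : Num.sqrt E ^+ 2 = E by rewrite sqr_sqrtr// ltW.
have [||||pi pic cpi] := @discrete_coupling_flow R S I x rho0 rho1 j h (Num.sqrt E)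
    (ltW h0) _ rho0_gt0 rho1_ge0 rho1_1 j0 jdivg.
- by rewrite sqrtr_gt0.
- move=> b c l /jnext[i [/xh//|/xh]]; by rewrite distrC.
- rewrite sE; apply: ler_wpM2l; first exact: sqr_ge0.
  by apply: (le_trans o2); rewrite lerDr.
- rewrite sE; apply: ler_wpM2l => //; exact: sqr_ge0.
- by exists pi => // l; rewrite -sE.
Qed.

End grid_transport.

(** * Cells of a convex set *)

Section gauge.
Context {R : realType} {V : normedModType R} (U : set V) (a b : R).
Hypothesis a0 : 0 < a.
Hypothesis aU : forall x, `|x| < a -> U x.
Hypothesis Ub : forall x, U x -> `|x| <= b.
Hypothesis oU : open U.
Hypothesis cU : forall x y (t : R), 0 <= t <= 1 -> U x -> U y -> U (t *: x + (1 - t) *: y).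

Definition gauge (x : V) : R := inf [set t | 0 < t /\ U (t^-1 *: x)].

Let U0 : U 0. Proof. by apply: aU; rewrite normr0. Qed.

Let gauge_set_ge0 x : has_lbound [set t | 0 < t /\ U (t^-1 *: x)].
Proof. by exists 0 => t [/ltW]. Qed.

Let gauge_set_inf x : has_inf [set t | 0 < t /\ U (t^-1 *: x)].
Proof.
split=> //; exists ((`|x| + 1) / a); split; first by rewrite divr_gt0// ltr_wpDl.
apply: aU; rewrite normrZ gtr0_norm ?invr_gt0 ?divr_gt0 ?ltr_wpDl//.
rewrite invf_div mulrAC ltr_pdivrMr ?ltr_wpDl// ltr_pM2l//.
by rewrite ltrDl.
Qed.

Lemma gauge_ge0 x : 0 <= gauge x.
Proof.
by apply: lb_le_inf; [case: (gauge_set_inf x)|move=> t [/ltW]].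
Qed.

(** One direction is convexity with the point 0, the other openness. This form with a strict
    inequality avoids any discussion of whether the infimum is attained; the later estimates reduce
    to it by adding a small [e]. *)
Lemma gauge_ltP x t : 0 < t -> (gauge x < t <-> U (t^-1 *: x)).
Proof.
move=> t0; split=> [/(inf_lt (gauge_set_inf x).1)[s /= [s0 Us] st]|Ut].
  have -> : t^-1 *: x = (s / t) *: (s^-1 *: x) + (1 - s / t) *: 0.
    by rewrite scaler0 addr0 scalerA; congr (_ *: _); field; rewrite !gt_eqF.
  apply: cU => //; rewrite divr_ge0 ?ltW//= ltr_pdivrMr ?mul1r//.
(* An open set contains a slightly larger dilate of each of its points. *)
have /nbhs_ballP[e /= e0 xeU] : nbhs (t^-1 *: x) U by exact: open_nbhs_nbhs.
pose s := t / (1 + e / (2 * (`|t^-1 *: x| + 1))).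
have d0 : 0 < e / (2 * (`|t^-1 *: x| + 1)) by rewrite divr_gt0// mulr_gt0// ltr_wpDl.
have s0 : 0 < s by rewrite divr_gt0// addr_gt0.
apply: (@le_lt_trans _ _ s); last first.
  by rewrite ltr_pdivrMr ?addr_gt0// mulrDr mulr1 ltrDl mulr_gt0.
apply: ge_inf => //; split=> //; apply: xeU.
rewrite -ball_normE /ball_/= /s.
have -> : t^-1 *: x - (t / (1 + e / (2 * (`|t^-1 *: x| + 1))))^-1 *: x =
    - (e / (2 * (`|t^-1 *: x| + 1))) *: (t^-1 *: x).
  rewrite -scalerBl scalerA; congr (_ *: _); field.
  by rewrite !gt_eqF//= ?ltr_wpDl ?addr_gt0 ?mulr_gt0 ?ltr_wpDl.
rewrite normrZ normrN gtr0_norm// mulrAC ltr_pdivrMr ?mulr_gt0 ?ltr_wpDl//.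
rewrite ltr_pM2l//; have : 0 <= `|t^-1 *: x| by []. lra.
Qed.

Lemma gauge0 : gauge 0 = 0.
Proof.
apply/eqP; rewrite eq_le gauge_ge0 andbT; apply/ler_addgt0Pr => e e0.
by rewrite add0r ltW//; apply/gauge_ltP => //; rewrite scaler0.
Qed.

Lemma gaugeZ c x : 0 < c -> gauge (c *: x) = c * gauge x.
Proof.
suff h k y : 0 < k -> gauge (k *: y) <= k * gauge y.
  move=> c0; apply/eqP; rewrite eq_le h//= -ler_pdivlMl//.
  by rewrite (le_trans _ (h _ _ _)) ?invr_gt0// scalerA mulVf ?scale1r// gt_eqF.
move=> k0; rewrite -ler_pdivrMl//; apply/ler_addgt0Pr => e e0.
rewrite ler_pdivrMl// ltW//.
have ge : 0 < gauge y + e by rewrite ltr_wpDl// gauge_ge0.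
apply/gauge_ltP; first by rewrite mulr_gt0.
rewrite scalerA invfM mulrAC mulVf ?gt_eqF// mul1r.
by apply/gauge_ltP => //; rewrite ltrDl.
Qed.

Lemma gaugeD x y : gauge (x + y) <= gauge x + gauge y.
Proof.
apply/ler_addgt0Pr => e e0.
have e20 : 0 < e / 2 by rewrite divr_gt0.
set s := gauge x + e / 2; set t := gauge y + e / 2.
have s0 : 0 < s by rewrite ltr_wpDl// gauge_ge0.
have t0 : 0 < t by rewrite ltr_wpDl// gauge_ge0.
have st0 : 0 < s + t by rewrite addr_gt0.
have -> : gauge x + gauge y + e = s + t by rewrite /s /t; lra.
apply/ltW/gauge_ltP => //.
have -> : (s + t)^-1 *: (x + y) =
    (s / (s + t)) *: (s^-1 *: x) + (1 - s / (s + t)) *: (t^-1 *: y).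
  rewrite !scalerA scalerDr; congr (_ *: _ + _ *: _); field; rewrite !gt_eqF//.
apply: cU.
- by rewrite divr_ge0 ?ltW//= ltr_pdivrMr// mul1r ltrDl.
- by apply/gauge_ltP => //; rewrite ltrDl.
- by apply/gauge_ltP => //; rewrite ltrDl.
Qed.

Lemma gauge_le_norm x : gauge x <= a^-1 * `|x|.
Proof.
apply/ler_addgt0Pr => e e0; have xe : 0 < a^-1 * `|x| + e.
  by rewrite ltr_wpDl// mulr_ge0// invr_ge0 ltW.
apply/ltW/gauge_ltP => //; apply: aU.
rewrite normrZ gtr0_norm ?invr_gt0// ltr_pdivrMl// mulrDl.
by rewrite mulrAC mulVf ?gt_eqF// mul1r ltrDl mulr_gt0.
Qed.

Lemma norm_le_gauge x : 0 < b -> b^-1 * `|x| <= gauge x.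
Proof.
move=> b0; apply/ler_addgt0Pr => e e0.
have xe : 0 < gauge x + e by rewrite ltr_wpDl// gauge_ge0.
have /gauge_ltP : gauge x < gauge x + e by rewrite ltrDl.
move=> /(_ xe)/Ub; rewrite normrZ gtr0_norm ?invr_gt0//.
by rewrite !ler_pdivrMl// mulrC.
Qed.

Lemma gauge_lipschitz x y : `|gauge x - gauge y| <= a^-1 * `|x - y|.
Proof.
have h u v : gauge u - gauge v <= a^-1 * `|u - v|.
  rewrite lerBlDr (le_trans _ (lerD (gauge_le_norm _) (lexx _)))//.
  by rewrite -{1}(subrK v u) gaugeD.
by rewrite ler_norml h lerNl opprB distrC h.
Qed.

Lemma gauge_lt1 x : gauge x < 1 <-> U x.
Proof. by rewrite gauge_ltP// invr1 scale1r. Qed.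

End gauge.

Section radial_map.
Context {R : realType} {V : normedModType R}.
Implicit Types p q : V -> R.

(** Each ray is rescaled so that [q] at the image equals [p] at the point, which carries the unit
    ball of [p] to that of [q]. At 0 the value of the quotient is irrelevant. *)
Definition radial p q (x : V) := (p x / q x) *: x.

(** In the difference of two images, the ratio [p x / q x] multiplying [x - y] is at most [M / m];
    the variation of the ratio multiplies [y], and its denominator [q y] compensates the size of
    [y]. *)
Lemma radial_lipschitz p q (M m : R) : 0 < m ->
  (forall x, 0 <= p x) -> p 0 = 0 ->
  (forall x y, `|p x - p y| <= M * `|x - y|) ->
  (forall x y, `|q x - q y| <= M * `|x - y|) ->
  (forall x, m * `|x| <= q x) ->
  forall x y, `|radial p q x - radial p q y| <=
    (M / m + (M / m + 1) * (M / m)) * `|x - y|.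
Proof.
move=> m0 p0 p00 pM qM mq.
have [M0|M0] := leP 0 M; last first.
  have z (u : V) : `|u| = 0.
    apply/eqP; rewrite eq_le normr_ge0 andbT -(ler_nM2l M0) mulr0.
    by rewrite -[u in leRHS]subr0 (le_trans _ (pM u 0)).
  by move=> x y; rewrite !z mulr0.
have pMx x : p x <= M * `|x|.
  by have := pM x 0; rewrite p00 !subr0 ger0_norm.
have q0 x : x != 0 -> 0 < q x.
  by move=> x0; apply: lt_le_trans (mq x); rewrite mulr_gt0// normr_gt0.
have pq x : `|p x / q x| <= M / m.
  have [->|x0] := eqVneq x 0; first by rewrite p00 mul0r normr0 divr_ge0// ltW.
  have qx := q0 _ x0; rewrite ger0_norm; last by rewrite divr_ge0// ltW.
  rewrite ler_pdivrMr//.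
  rewrite (le_trans (pMx x))// -mulrA ler_wpM2l// ler_pdivlMl//.
have C0 : 0 <= (M / m + 1) * (M / m).
  by rewrite mulr_ge0 ?addr_ge0 ?divr_ge0 ?(ltW m0).
move=> x y; have [->|x0] := eqVneq x 0.
  rewrite /radial scaler0 !sub0r !normrN normrZ ler_wpM2r//.
  by rewrite (le_trans (pq _))// lerDl.
have qx := q0 _ x0.
have [->|y0] := eqVneq y 0.
  rewrite /radial scaler0 !subr0 normrZ ler_wpM2r//.
  by rewrite (le_trans (pq _))// lerDl.
have qy := q0 _ y0.
have -> : radial p q x - radial p q y =
    (p x / q x) *: (x - y) + (p x / q x - p y / q y) *: y.
  by rewrite /radial scalerBr scalerBl addrA subrK.
rewrite (le_trans (ler_normD _ _))// [leRHS]mulrDl (normrZ _ (x - y)) (normrZ _ y).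
apply: lerD; first by rewrite ler_wpM2r.
have -> : p x / q x - p y / q y =
    (p x / q x * (q y - q x) + (p x - p y)) / q y.
  by field; rewrite !gt_eqF.
rewrite normrM normfV (gtr0_norm qy) -[leLHS]mulrA.
have yq : (q y)^-1 * `|y| <= m^-1.
  by rewrite ler_pdivrMl// mulrC ler_pdivlMl.
have : `|p x / q x * (q y - q x) + (p x - p y)| <= (M / m + 1) * M * `|x - y|.
  rewrite (le_trans (ler_normD _ _))// normrM -mulrA mulrDl mul1r lerD//.
  by rewrite ler_pM// distrC.
move=> h; apply: (le_trans (ler_pM _ _ h yq)) => //.
  by rewrite mulr_ge0// invr_ge0 ltW.
rewrite le_eqVlt; apply/orP; left; apply/eqP; field; exact: lt0r_neq0.
Qed.

Lemma radialK p q (x : V) : (forall c y, 0 < c -> p (c *: y) = c * p y) ->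
  (forall c y, 0 < c -> q (c *: y) = c * q y) ->
  (x != 0 -> 0 < p x) -> (x != 0 -> 0 < q x) ->
  radial p q (radial q p x) = x.
Proof.
move=> pZ qZ p0 q0; have [->|x0] := eqVneq x 0; first by rewrite /radial !scaler0.
have qx := q0 x0; have px := p0 x0.
rewrite /radial pZ ?divr_gt0// qZ ?divr_gt0// scalerA -[RHS]scale1r.
by congr (_ *: _); field; rewrite !gt_eqF.
Qed.

Lemma radial_eval p q (x : V) : (forall c y, 0 < c -> q (c *: y) = c * q y) ->
  q 0 = 0 -> p 0 = 0 -> (x != 0 -> 0 < p x) -> (x != 0 -> 0 < q x) -> q (radial p q x) = p x.
Proof.
move=> qZ q00 p00 p0 q0; have [->|x0] := eqVneq x 0.
  by rewrite /radial scaler0 q00 p00.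
rewrite /radial qZ ?divr_gt0 ?p0 ?q0// divfK//.
by rewrite gt_eqF// q0.
Qed.

End radial_map.

Section row_norm.
Context {R : realType} {n : nat}.
Implicit Types v : 'rV[R]_n.

Let rv_normE v : `|v| = \big[Num.max/0]_ij `|v ij.1 ij.2|.
Proof. by rewrite -mx_normrE. Qed.

Lemma norm_rV_ltP v (r : R) : 0 < r -> (forall i, `|v 0 i| < r) <-> `|v| < r.
Proof.
move=> r0; split=> [h|].
  rewrite rv_normE; apply/bigmax_ltP; split=> // -[i j] _ /=.
  by rewrite ord1.
rewrite rv_normE => /bigmax_ltP[_ h] i.
exact: (h (0, i)).
Qed.

Lemma norm_rV_leP v (r : R) : 0 <= r -> (forall i, `|v 0 i| <= r) <-> `|v| <= r.
Proof.
move=> r0; split=> [h|].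
  rewrite rv_normE; apply/bigmax_leP; split=> // -[i j] _ /=.
  by rewrite ord1.
rewrite rv_normE => /bigmax_leP[_ h] i.
exact: (h (0, i)).
Qed.

Lemma coord_le_norm v i : `|v 0 i| <= `|v|.
Proof. by apply: (norm_rV_leP v (normr_ge0 v)).2. Qed.

Lemma lebesgue_rV_ball v (r : R) : 0 <= r ->
  lebesgue_rV n [set w | forall i, `|v 0 i - w 0 i| < r] = ((2 * r) ^+ n)%:E.
Proof.
move=> r0.
rewrite (lebesgue_rV_box (A := fun i => ball (v 0 i) r)); last first.
  by move=> i; exact: measurable_ball.
under eq_bigr do rewrite lebesgue_measure_ball//.
rewrite prodEFin; congr (_%:E).
by rewrite prodr_const card_ord -(mulr_natl r 2).
Qed.

Lemma open_lipschitz_lt (f : 'rV[R]_n -> R) M (u : R) :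
  (forall x y, `|f x - f y| <= M * `|x - y|) -> open [set x | f x < u].
Proof.
move=> fM; rewrite openE => x /= fxu; apply/nbhs_ballP.
have M1 : 0 < `|M| + 1 by rewrite ltr_wpDl.
exists ((u - f x) / (`|M| + 1)) => /=; first by rewrite divr_gt0// subr_gt0.
move=> y; rewrite -ball_normE /ball_/= ltr_pdivlMr// => xy.
have := fM y x; rewrite distrC => h.
have : f y - f x < u - f x; last by lra.
rewrite (le_lt_trans (ler_norm _))// (le_lt_trans (fM _ _))//.
apply: le_lt_trans xy; rewrite distrC mulrC ler_wpM2l//.
by rewrite (le_trans (ler_norm _))// lerDl.
Qed.

Lemma measurable_lipschitz_itv (f : 'rV[R]_n -> R) M (u v : R) :
  (forall x y, `|f x - f y| <= M * `|x - y|) -> measurable [set x | u <= f x < v].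
Proof.
move=> fM.
have -> : [set x | u <= f x < v] = [set x | f x < v] `\` [set x | f x < u].
  apply/seteqP; split=> x /=.
    by move=> /andP[uf fv]; split=> //; apply/negP; rewrite -leNgt.
  by move=> [-> /negP]; rewrite -leNgt => ->.
by apply: measurableD; apply: measurable_open_rV; exact: open_lipschitz_lt fM.
Qed.

End row_norm.

Lemma convex_set_comb {R : realType} {n} (A : set 'rV[R]_n) (x y : 'rV[R]_n) (t : R) :
  convex_set A -> 0 <= t <= 1 -> A x -> A y -> A (t *: x + (1 - t) *: y).
Proof.
move=> cA /andP[t0 t1] Ax Ay.
by have := cA x y (Itv01 t0 t1) (mem_set Ax) (mem_set Ay); rewrite inE.
Qed.

Section cell_decomposition.
Context {R : realType} {n : nat} (Omega : set 'rV[R]_n).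
Hypotheses (Omega0 : Omega !=set0) (oOmega : open Omega)
  (bOmega : bounded_set Omega) (cOmega : convex_set Omega).

(** The unit ball of the sup norm is a cube. After translating a point of [Omega] to 0, the gauge of
    [Omega] and the sup norm are both Lipschitz, positively homogeneous and bounded below by a
    multiple of the norm, so exchanging them along rays is bi-Lipschitz. *)
Lemma bilipschitz_cube : exists (F G : 'rV[R]_n -> 'rV[R]_n) (C : R),
  [/\ 0 < C, forall x y, `|F x - F y| <= C * `|x - y|,
      forall x y, `|G x - G y| <= C * `|x - y|,
      forall x, F (G x) = x /\ G (F x) = x &
      forall x, Omega x <-> `|F x| < 1].
Proof.
have [y0 Oy0] := Omega0.
have [B [_ hB]] := bOmega; pose b0 := B + 1.
have hb x : Omega x -> `|x| <= b0 by apply: hB; rewrite ltrDl.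
have /nbhs_ballP[a /= a0 aO] : nbhs y0 Omega by exact: open_nbhs_nbhs.
pose U := [set x | Omega (x + y0)].
have aU x : `|x| < a -> U x.
  move=> xa; apply: aO; rewrite -ball_normE /ball_/=.
  by rewrite opprD addrCA subrr addr0 normrN.
pose b := `|b0| + `|y0| + 1.
have b1 : 0 < b by rewrite ltr_wpDl// addr_ge0.
have Ub x : U x -> `|x| <= b.
  move=> Ux; have xb := hb _ Ux.
  rewrite -(addrK y0 x) (le_trans (ler_normB _ _))// /b.
  by have := ler_norm b0; lra.
have oU : open U.
  rewrite openE => x Ux; have /nbhs_ballP[e /= e0 eO] : nbhs (x + y0) Omega.
    exact: open_nbhs_nbhs.
  apply/nbhs_ballP; exists e => //= y; rewrite -ball_normE /ball_/= => xy.
  apply: eO; rewrite -ball_normE /ball_/=.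
  by rewrite opprD addrACA subrr addr0.
have cU x y (t : R) : 0 <= t <= 1 -> U x -> U y -> U (t *: x + (1 - t) *: y).
  move=> t01 Ux Uy; rewrite /U/=.
  have -> : t *: x + (1 - t) *: y + y0 = t *: (x + y0) + (1 - t) *: (y + y0).
    by rewrite !scalerDr addrACA -scalerDl [t + _]addrC subrK scale1r.
  exact: convex_set_comb.
pose g := gauge U; pose N (x : 'rV[R]_n) : R := `|x|.
pose M := a^-1 + 1; pose m := Num.min b^-1 1.
have m0 : 0 < m by rewrite lt_min invr_gt0 b1 ltr01.
have gM x y : `|g x - g y| <= M * `|x - y|.
  rewrite (le_trans (gauge_lipschitz a0 aU oU cU _ _))// ler_wpM2r//.
  by rewrite /M lerDl.
have NM x y : `|N x - N y| <= M * `|x - y|.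
  rewrite (le_trans (ler_dist_dist _ _))// /M mulrDl mul1r lerDr mulr_ge0//.
  by rewrite invr_ge0 ltW.
have mg x : m * `|x| <= g x.
  apply: le_trans (norm_le_gauge a0 aU Ub oU cU x b1).
  by rewrite ler_wpM2r// ge_min lexx.
have mN x : m * `|x| <= N x.
  by rewrite -[leRHS]mul1r ler_wpM2r// ge_min lexx orbT.
have gp x : x != 0 -> 0 < g x.
  by move=> x0; apply: lt_le_trans (mg x); rewrite mulr_gt0// normr_gt0.
have Np x : x != 0 -> 0 < N x by rewrite normr_gt0.
have gZ c x : 0 < c -> g (c *: x) = c * g x by move=> c0; exact: (gaugeZ a0).
have NZ c x : 0 < c -> N (c *: x) = c * N x.
  by move=> c0; rewrite /N normrZ gtr0_norm.
have g0 : g 0 = 0 by exact: (gauge0 a0).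
have N0 : N 0 = 0 by exact: normr0.
have gge0 x : 0 <= g x by exact: (gauge_ge0 a0).
exists (fun y => radial g N (y - y0)), (fun x => radial N g x + y0),
  (M / m + (M / m + 1) * (M / m)).
have M0 : 0 < M by rewrite ltr_wpDl// invr_ge0 ltW.
split.
- have Mm : 0 < M / m by rewrite divr_gt0.
  by rewrite addr_gt0// mulr_gt0// addr_gt0.
- move=> x y; rewrite (le_trans (radial_lipschitz m0 gge0 g0 gM NM mN _ _))//.
  by rewrite opprB addrA subrK.
- move=> x y; rewrite opprD addrACA subrr addr0.
  exact: (radial_lipschitz m0 (@normr_ge0 _ _) N0 NM gM mg).
- move=> x; rewrite addrK (radialK gZ NZ (gp x) (Np x)); split=> //.
  by rewrite (radialK NZ gZ (Np _) (gp _)) subrK.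
- move=> x; have -> : `|radial g N (x - y0)| = g (x - y0).
    exact: (radial_eval NZ N0 g0 (gp _) (Np _)).
  have := gauge_lt1 a0 aU oU cU (x - y0); rewrite /U/= subrK => h.
  by split => /h.
Qed.

(* The witness [cell k] is the preimage, under a bi-Lipschitz map of [Omega] onto the cube
   [(-1, 1)^n], of the [k]-th cube of the regular grid with [m] cubes per side. *)
Lemma cell_decomposition : exists c1 c2 c3 : R, [/\ 0 < c1, 0 < c2, 0 < c3 &
  forall m, (0 < m)%N ->
  exists (cell : {ffun 'I_n -> 'I_m} -> set 'rV[R]_n) (pt : {ffun 'I_n -> 'I_m} -> 'rV[R]_n),
  [/\ forall k, measurable (cell k),
      trivIset setT cell,
      \bigcup_k cell k = Omega,
      forall k, ((c1 / m%:R ^+ n)%:E <= lebesgue_rV n (cell k) <= (c2 / m%:R ^+ n)%:E)%E &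
      (forall k x, cell k x -> `|x - pt k| <= c3 / m%:R) /\
      (forall i k l, next_cell i k l -> `|pt k - pt l| <= c3 / m%:R)]].
Proof.
have [F [G [C [C0 FC GC FG OF]]]] := bilipschitz_cube.
(* Each cell contains a sup-norm ball of radius [(2 * C * m)^-1] and lies in one of radius
   [2 * C / m]; their explicit volumes give [c1] and [c2] with no change of variables. Centres of
   neighbouring cubes are [2 / m] apart, whence [c3]. *)
exists (C^-1 ^+ n), ((4 * C) ^+ n), (2 * C).
split; rewrite ?exprn_gt0 ?invr_gt0 ?mulr_gt0// => m m0.
have mR : 0 < m%:R :> R by rewrite ltr0n.
pose S := {ffun 'I_n -> 'I_m}.
pose Q (k : S) : set 'rV[R]_n :=
  [set z | forall i, (k i)%:R <= (z 0 i + 1) * m%:R / 2 < (k i).+1%:R].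
(* The half-open cubes [Q k] tile [[-1, 1)^n] without overlap; the intersection with [Omega]
   discards the boundary faces at [-1]. *)
pose cell k := Omega `&` F @^-1` Q k.
pose ctr (k : S) : 'rV[R]_n := \row_i ((2 * (k i)%:R + 1) / m%:R - 1).
have ctrE (k : S) (z : 'rV[R]_n) i :
    (z - ctr k) 0 i = ((z 0 i + 1) * m%:R / 2 - ((k i)%:R + 1 / 2)) * (2 / m%:R).
  by rewrite !mxE; field; rewrite gt_eqF.
have Qctr k z : Q k z -> `|z - ctr k| <= m%:R^-1.
  move=> Qz; apply/norm_rV_leP; first by rewrite invr_ge0.
  move=> i; have := Qz i; rewrite -[(k i).+1%:R]natr1 ctrE => /andP[z1 z2].
  rewrite normrM [X in _ * X]ger0_norm ?divr_ge0// mulrA ler_pdivrMr//.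
  rewrite mulVf ?gt_eqF// -ler_pdivlMr// ler_norml; lra.
have ctrQ k z : `|z - ctr k| < m%:R^-1 -> Q k z /\ `|z| < 1.
  move=> /norm_rV_ltP h.
  have {}h i : (k i)%:R < (z 0 i + 1) * m%:R / 2 < (k i).+1%:R.
    have := h _ i; rewrite invr_gt0 => /(_ mR); rewrite ctrE.
    rewrite normrM [X in _ * X]ger0_norm ?divr_ge0// mulrA ltr_pdivrMr//.
    by rewrite mulVf ?gt_eqF// -ltr_pdivlMr// ltr_norml -[(k i).+1%:R]natr1; lra.
  split; first by move=> i; have /andP[/ltW -> ->] := h i.
  apply/norm_rV_ltP => // i; have /andP[h1 h2] := h i.
  have h3 : 0 < (z 0 i + 1) * m%:R / 2 by apply: le_lt_trans h1.
  have h4 : (z 0 i + 1) * m%:R / 2 < m%:R.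
    by apply: (lt_le_trans h2); rewrite ler_nat.
  have : 0 < z 0 i + 1 by move: h3; rewrite pmulr_lgt0// pmulr_lgt0.
  have : (z 0 i + 1) / 2 < 1.
    by move: h4; rewrite mulrAC -[ltRHS]mul1r ltr_pM2r.
  by rewrite ltr_norml; lra.
have cellE k x : cell k x <-> Omega x /\ Q k (F x) by [].
exists cell, (fun k => G (ctr k)).
have cell_near k x : cell k x -> `|x - G (ctr k)| <= C / m%:R.
  move=> [_ /Qctr h]; have [_ GFx] := FG x.
  by rewrite -{1}GFx (le_trans (GC _ _))// ler_pM2l.
have near_cell k x : `|x - G (ctr k)| < (C * m%:R)^-1 -> cell k x.
  move=> h; suff /ctrQ[Qk F1] : `|F x - ctr k| < m%:R^-1 by split => //; apply/OF.
  have [FGx _] := FG (ctr k); rewrite -{1}FGx (le_lt_trans (FC _ _))//.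
  by rewrite -ltr_pdivlMl// -invfM.
have mcell k : measurable (cell k).
  apply: measurableI; first exact: measurable_open_rV.
  rewrite /Q (_ : F @^-1` _ = \bigcap_(i in [set: 'I_n])
    [set x | (k i)%:R <= (F x 0 i + 1) * m%:R / 2 < (k i).+1%:R]); last first.
    by apply/seteqP; split=> x /= h i; [move=> _|]; apply: h.
  apply: fin_bigcap_measurable => [|i _]; first exact: finite_finset.
  apply: (@measurable_lipschitz_itv _ _ (fun x => (F x 0 i + 1) * m%:R / 2)
    (C * m%:R / 2)) => x y.
  have -> : (F x 0 i + 1) * m%:R / 2 - (F y 0 i + 1) * m%:R / 2 =
      (F x - F y) 0 i * (m%:R / 2) by rewrite !mxE; field.
  rewrite normrM [X in _ * X]ger0_norm ?divr_ge0//.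
  rewrite [leRHS](_ : _ = C * `|x - y| * (m%:R / 2)); last by field.
  by rewrite ler_wpM2r ?divr_ge0// (le_trans (coord_le_norm _ _)).
split=> //.
- move=> k l _ _ [x [[_ kx] [_ lx]]]; apply/ffunP => i; apply/val_inj.
  have /andP[k1 k2] := kx i; have /andP[l1 l2] := lx i.
  apply/eqP; rewrite eqn_leq -ltnS -[X in _ && X]ltnS -!(ltr_nat R).
  by rewrite (le_lt_trans k1)// (le_lt_trans l1).
- apply/seteqP; split=> [x [k _ []]//|x Ox].
  have /OF/norm_rV_ltP Fx := Ox.
  have w i : 0 <= (F x 0 i + 1) * m%:R / 2 < m%:R.
    have := Fx ltr01 i; rewrite ltr_norml => /andP[x1 x2].
    rewrite divr_ge0 ?mulr_ge0//=; last by lra.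
    by rewrite mulrAC gtr_pMl//; lra.
  have wm (i : 'I_n) : (Num.truncn ((F x 0 i + 1) * m%:R / 2)%R < m)%N.
    by have /andP[w0 w1] := w i; rewrite -(ltr_nat R) (le_lt_trans _ w1)// truncn_le.
  exists [ffun i => Ordinal (wm i)] => //; split=> // i.
  by rewrite ffunE/=; apply: truncn_itv; case/andP: (w i).
- move=> k; apply/andP; split.
    have -> : C^-1 ^+ n / m%:R ^+ n = (2 * (C * m%:R * 2)^-1) ^+ n :> R.
      rewrite -exprVn -exprMn; congr (_ ^+ n); field.
      by rewrite !gt_eqF.
    rewrite -(lebesgue_rV_ball (G (ctr k))); last by rewrite invr_ge0 !mulr_ge0// ltW.
    apply: le_measure; rewrite ?inE.
    + apply: (measurable_box (A := fun i => ball (G (ctr k) 0 i) _)) => i.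
      exact: measurable_ball.
    + exact: mcell.
    + move=> x /= h; apply: near_cell; apply/norm_rV_ltP.
        by rewrite invr_gt0 mulr_gt0.
      move=> i; rewrite !mxE distrC (lt_trans (h i))//.
      by rewrite ltf_pV2 ?posrE ?mulr_gt0// ltr_pMr ?mulr_gt0// ltr1n.
  have -> : (4 * C) ^+ n / m%:R ^+ n = (2 * (2 * C / m%:R)) ^+ n :> R.
    rewrite -exprVn -exprMn; congr (_ ^+ n); field.
    by rewrite !gt_eqF.
  rewrite -(lebesgue_rV_ball (G (ctr k))); last by rewrite divr_ge0 ?mulr_ge0// ltW.
  apply: le_measure; rewrite ?inE.
  + exact: mcell.
  + apply: (measurable_box (A := fun i => ball (G (ctr k) 0 i) _)) => i.
    exact: measurable_ball.
  + move=> x /= /cell_near h i; rewrite distrC.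
    have -> : x 0 i - G (ctr k) 0 i = (x - G (ctr k)) 0 i by rewrite !mxE.
    rewrite (le_lt_trans (coord_le_norm _ _))// (le_lt_trans h)//.
    by rewrite ltr_pM2r ?invr_gt0// ltr_pMl// ltr1n.
- split=> [k x /cell_near h|i k l /forallP kl].
    by rewrite (le_trans h)// ler_pM2r ?invr_gt0// ler_peMl ?ler1n// ltW.
  rewrite (le_trans (GC _ _))// mulrAC [leRHS]mulrC ler_pM2l//.
  apply/norm_rV_leP; first by rewrite divr_ge0.
  move=> i0; rewrite ctrE mxE.
  have -> : (l i0)%:R = (k i0)%:R + (i0 == i)%:R :> R by rewrite -natrD; congr (_%:R); exact/eqP.
  have -> : ((2 * (k i0)%:R + 1) / m%:R - 1 + 1) * m%:R / 2 -
    ((k i0)%:R + (i0 == i)%:R + 1 / 2) = - (i0 == i)%:R :> R by field; rewrite gt_eqF.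
  rewrite mulNr normrN ger0_norm ?mulr_ge0 ?divr_ge0// ler_piMl ?divr_ge0//.
  by rewrite lern1 leq_b1.
Qed.

End cell_decomposition.

(** * Scaling of Lebesgue measure and linear statistics *)

Section image_measure.
Local Open Scope ereal_scope.
Context d1 d2 (T1 : measurableType d1) (T2 : measurableType d2) (R : realType).
Variables (m : {measure set T1 -> \bar R}) (f : T1 -> T2).
Hypothesis mf : measurable_fun [set: T1] f.

(* [pushforward] with the measurability proof as an argument, so that the
   measure structure can be inferred. *)
Definition image_measure & measurable_fun [set: T1] f : set T2 -> \bar R :=
  pushforward m f.

Let image_measure0 : image_measure mf set0 = 0.
Proof. by rewrite /image_measure /pushforward preimage_set0 measure0. Qed.

Let image_measure_ge0 A : 0 <= image_measure mf A.
Proof. exact: measure_ge0. Qed.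

Let image_measure_sigma_additive : semi_sigma_additive (image_measure mf).
Proof.
move=> F mF tF mUF; rewrite /image_measure /pushforward preimage_bigcup.
apply: measure_semi_sigma_additive.
- by move=> n; rewrite -[X in measurable X]setTI; exact: mf.
- apply/trivIsetP => /= i j _ _ ij; rewrite -preimage_setI.
  by move/trivIsetP : tF => /(_ _ _ _ _ ij) ->//; rewrite preimage_set0.
- by rewrite -preimage_bigcup -[X in measurable X]setTI; exact: mf.
Qed.

HB.instance Definition _ := isMeasure.Build _ _ _ (image_measure mf)
  image_measure0 image_measure_ge0 image_measure_sigma_additive.

End image_measure.

Section lebesgue_scaling.
Context {R : realType} (s : R) (s0 : 0 < s).
Local Open Scope ereal_scope.

Let scale1 (x : measurableTypeR R) : measurableTypeR R := (s * (x : R))%R.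

Let mscale1 : measurable_fun setT scale1.
Proof. exact: measurable_funM. Qed.

Lemma lebesgue_measure_scale (A : set R) : measurable A ->
  lebesgue_measure ((fun x : R => (s * x)%R) @^-1` A) = (s^-1)%:E * lebesgue_measure A.
Proof.
move=> mA.
pose mu : {measure set (measurableTypeR R) -> \bar R} :=
  mscale (NngNum (ltW s0)) (image_measure lebesgue_measure mscale1).
have mscaleE X : mu X = s%:E * lebesgue_measure (scale1 @^-1` X) by [].
have -> : lebesgue_measure A = mu A.
  apply: lebesgue_measure_unique => // _ [[a b] _ <-] /=.
  rewrite mscaleE.
  have -> : scale1 @^-1` `]a, b] = [set` `](a / s)%R, (b / s)%R]].
    apply/seteqP; split=> x; rewrite /scale1/= !in_itv/= => /andP[ax xb].
      by rewrite ltr_pdivrMr// mulrC ax ler_pdivlMr// mulrC.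
    by move: ax xb; rewrite ltr_pdivrMr// ler_pdivlMr// mulrC => -> ->.
  rewrite !lebesgue_measure_itv/= !lte_fin ltr_pM2r ?invr_gt0//.
  case: ifPn => _; last by rewrite mule0.
  by rewrite -!EFinD -EFinM; congr (_%:E); field; rewrite gt_eqF.
by rewrite mscaleE muleA -EFinM mulVf ?gt_eqF// mul1e.
Qed.

Lemma measurable_scale_rV n : measurable_fun setT (fun x : 'rV[R]_n => s *: x).
Proof.
apply: measurable_fun_rV => i; under eq_fun do rewrite mxE.
by apply: measurable_funM => //; exact: measurable_coord.
Qed.

(** Uniqueness of measures: both sides agree on boxes, which form a generating class stable under
    intersection, and the cubes [g k] of finite measure exhaust the space. *)
Lemma lebesgue_rV_scale n (A : set 'rV[R]_n) : measurable A ->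
  lebesgue_rV n ((fun x : 'rV[R]_n => s *: x) @^-1` A) = ((s^-1) ^+ n)%:E * lebesgue_rV n A.
Proof.
move=> mA.
have sn0 : (0 <= s ^+ n)%R by rewrite exprn_ge0// ltW.
pose mu : {measure set 'rV[R]_n -> \bar R} :=
  mscale (NngNum sn0) (image_measure (lebesgue_rV n) (@measurable_scale_rV n)).
have muE X : mu X = (s ^+ n)%:E * lebesgue_rV n ((fun x : 'rV[R]_n => s *: x) @^-1` X) by [].
pose box (A : 'I_n -> set R) := [set v : 'rV[R]_n | forall i, A i (v 0%R i)].
pose G : set (set 'rV[R]_n) := [set B | exists2 A, (forall i, measurable (A i)) & B = box A].
pose g k := box (fun=> `](- k%:R)%R, k%:R%R]%classic).
have mg k (i : 'I_n) : measurable (`](- k%:R)%R, k%:R%R]%classic : set R) by [].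
suff -> : lebesgue_rV n A = mu A.
  rewrite muE muleA -EFinM -exprMn mulVf ?gt_eqF// expr1n.
  by rewrite mul1e.
apply: (measure_unique G g) => //.
- apply/seteqP; split; last first.
    apply: smallest_sub; first exact: sigma_algebra_measurable.
    by move=> _ [B mB ->]; exact: measurable_box.
  apply: smallest_sub; first exact: smallest_sigma_algebra.
  rewrite -bigcup_seq; apply: bigcup_sub => i _ _ [B mB <-]; rewrite setTI.
  apply: sub_sigma_algebra; exists (fun j => if j == i then B else setT).
    by move=> j; case: ifPn.
  apply/seteqP; split=> v /=; first by move=> Bv j; case: eqP => // ->.
  by move=> /(_ i); rewrite eqxx.
- move=> _ _ [B mB ->] [C mC ->]; exists (fun i => B i `&` C i).
    by move=> i; exact: measurableI.
  apply/seteqP; split=> v /=; first by move=> [Bv Cv] i; split.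
  by move=> h; split=> i; have [] := h i.
- by move=> k; exists (fun=> `](- k%:R)%R, k%:R%R]%classic).
- rewrite -subTset => v _; exists (Num.truncn `|v|).+1 => // i.
  have h := coord_le_norm v i; have := truncnS_gt `|v|.
  rewrite /= in_itv/=; move: h; rewrite ler_norml => /andP[h1 h2] h3.
  by rewrite (le_trans h2 (ltW h3)) andbT (lt_le_trans _ h1)// ltrN2.
- move=> _ [B mB ->]; rewrite muE.
  have -> : (fun x : 'rV[R]_n => (s *: x)%R) @^-1` box B =
      box (fun i => (fun x : R => (s * x)%R) @^-1` B i).
    by apply/seteqP; split=> v /= h i; have := h i; rewrite !mxE.
  have mBs i : measurable ((fun x : R => (s * x)%R) @^-1` B i).
    rewrite -[X in measurable X]setTI.
    exact: (measurable_funM (measurable_cst _) (@measurable_id _ _ _)).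
  rewrite (lebesgue_rV_box mBs).
  under [in RHS]eq_bigr do rewrite lebesgue_measure_scale//.
  rewrite big_split/= prodEFin prodr_const card_ord muleA -EFinM -exprMn.
  by rewrite divff ?gt_eqF// expr1n mul1e (lebesgue_rV_box mB).
- move=> k; suff : lebesgue_rV n (g k) < +oo by [].
  rewrite (lebesgue_rV_box (mg k)).
  under eq_bigr do rewrite lebesgue_measure_itv/= -EFinB.
  rewrite (eq_bigr (fun=> (if (- k%:R < k%:R :> R)%R then k%:R - - k%:R else 0)%:E)).
    by rewrite prodEFin ltry.
  by move=> i _; rewrite lte_fin; case: ifPn.
Qed.
End lebesgue_scaling.

(** If [A] were infinite, the sets missing only finitely many points of [A] would form a proper
    filter [F] containing a compact ball. A cluster point of [F] is a limit point of [A], because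
    removing one point from [A] stays in [F]. *)
Lemma finite_set_bounded_no_limit_point {R : realType} n (A : set 'rV[R]_n) :
  limit_point A = set0 -> bounded_set A -> finite_set A.
Proof.
move=> A0 [B [_ hB]]; apply: contrapT => infA.
pose K := [set x : 'rV[R]_n | `|x| <= B + 1].
have AK : A `<=` K by apply: hB; rewrite ltrDl.
have cK : compact K.
  apply: bounded_closed_compact.
    by exists (B + 1); split; [exact: num_real|move=> r Br x /le_trans; apply; exact: ltW].
  have -> : K = ~` [set x | - `|x| < - (B + 1)].
    by apply/seteqP; split=> x; rewrite /K/= ltrN2 leNgt => /negP.
  apply: open_closedC; apply: (@open_lipschitz_lt _ _ _ 1) => x y.
  by rewrite mul1r opprK addrC (le_trans (ler_dist_dist _ _))// distrC.
pose F := [set S | finite_set (A `\` S)].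
have FF : ProperFilter F.
  split; first by rewrite /F/= setD0.
  split=> [|S S' fS fS'|S S' SS' fS].
  - by rewrite /F/= setDT; exact: finite_set0.
  - by rewrite /F/= setDIr finite_setU.
  - by apply: sub_finite_set fS; exact: setDS.
have FK : F K by rewrite /F/= (_ : A `\` K = set0) ?setD_eq0//; exact: finite_set0.
have [p [_ Fp]] := cK F FF FK.
suff : limit_point A p by rewrite A0.
move=> U Up; have FAp : F (A `\ p).
  by rewrite /F/= setDD; apply: sub_finite_set (finite_set1 p) => x [].
by have [y [[Ay yp] Uy]] := Fp _ _ FAp Up; exists y; split=> //; exact/eqP.
Qed.

Section linear_statistics.
Context disp {T : measurableType disp} {R : realType} (P : probability T R) {n : nat}.
Variables (Xi : T -> set 'rV[R]_n) (Omega : set 'rV[R]_n) (L c C0 : R).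
Hypotheses (n0 : (0 < n)%N) (ppXi : point_process Xi)
  (bOmega : bounded_set Omega) (L0 : 0 < L).
Hypothesis homXi : forall f : 'rV[R]_n -> \bar R, measurable_fun setT f ->
  (forall x, 0 <= f x)%E ->
  (\int[P]_w (\esum_(x in Xi w) f x) = c%:E * \int[lebesgue_rV n]_x f x)%E.
Hypothesis varXi : forall f : 'rV[R]_n -> R, f \_ Omega \in Lfun (lebesgue_rV n) 2%:E ->
  ('V_P[fun w => (\sum_(x \in dilation L Xi w) (f \_ Omega) x)%R]
   <= (C0 * L)%:E * 'N[lebesgue_rV n]_2%:E[EFin \o f \_ Omega] ^+ 2)%E.

Let s := L `^ (- n%:R^-1).
Let s0 : 0 < s. Proof. exact: powR_gt0. Qed.

Definition points w := points_in Omega (dilation L Xi w).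
Definition point_count A w : R := \sum_(x <- points w) \1_A x.

Let sn : s^-1 ^+ n = L.
Proof.
rewrite /s powRN invrK -powR_mulrn ?powR_ge0// -powRrM mulVf ?powRr1 ?ltW//.
by rewrite pnatr_eq0 -lt0n.
Qed.

Let preimage_scale A w : A `<=` Omega ->
  dilation L Xi w `&` A = *:%R s @` (Xi w `&` *:%R s @^-1` A).
Proof.
move=> AO; apply/seteqP; split=> x.
  by move=> [[y Xy <-] Ay]; exists y.
by move=> [y [Xy Ay] <-]; split=> //; exists y.
Qed.

Lemma finite_preimage_scale A w : A `<=` Omega ->
  finite_set (Xi w `&` *:%R s @^-1` A).
Proof.
move=> AO; apply: finite_set_bounded_no_limit_point.
  rewrite -subset0 => x; rewrite -(ppXi.1 w) => Xx U /Xx[y [yx [Xy _] Uy]].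
  by exists y.
have [B [_ hB]] := bOmega; exists (s^-1 * (B + 1)); split; first exact: num_real.
move=> r Br x [_ /AO Ox]; apply: ltW; apply: le_lt_trans Br.
rewrite ler_pdivlMl// -(gtr0_norm s0) -normrZ.
by apply: hB Ox; rewrite ltrDl.
Qed.

Lemma finite_dilation A w : A `<=` Omega -> finite_set (dilation L Xi w `&` A).
Proof.
by move=> AO; rewrite preimage_scale//; exact/finite_image/finite_preimage_scale.
Qed.

Lemma point_countE A w : A `<=` Omega -> point_count A w = #|` points_in A (dilation L Xi w)|%:R.
Proof.
move=> AO; rewrite /point_count /points /points_in.
rewrite -(@fsbig_finite _ _ _ _ _ (\1_A : _ -> R))//; last exact: finite_dilation.
have fA := finite_dilation w AO.
transitivity (\sum_(x \in dilation L Xi w `&` A) (1 : R)); last first.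
  by rewrite fsbig_finite//= big_const_seq count_predT iter_addr addr0.
transitivity (\sum_(x \in dilation L Xi w `&` A) (\1_A x : R)).
  apply/esym/fsbig_widen => [x [Dx /AO]//|x [[Dx Ox] /not_andP[//|nA]]].
  by rewrite /= indicE memNset.
by apply: eq_fsbigr => x; rewrite inE => -[_ Ax]; rewrite indicE mem_set.
Qed.

(** Undoing the dilation brings the counts back to [counting] on [Xi], where the measurability and
    intensity hypotheses are stated. *)
Lemma point_count_counting A w : A `<=` Omega ->
  (point_count A w)%:E = counting (Xi w `&` *:%R s @^-1` A).
Proof.
move=> AO; rewrite point_countE// /counting asboolT; last exact: finite_preimage_scale.
congr (_%:R%:E); rewrite /points_in preimage_scale//.
rewrite fset_set_image; last exact: finite_preimage_scale.
by rewrite card_imfset//; apply: scalerI; rewrite gt_eqF.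
Qed.

Let measurable_scale_preimage (A : set 'rV[R]_n) : measurable A ->
  measurable ( *:%R s @^-1` A : set 'rV[R]_n).
Proof.
by move=> mA; rewrite -[X in measurable X]setTI; exact: measurable_scale_rV.
Qed.

Lemma measurable_point_count A : A `<=` Omega -> measurable A ->
  measurable_fun setT (point_count A).
Proof.
move=> AO mA; apply/measurable_EFinP.
rewrite (_ : EFin \o _ = fun w => counting (Xi w `&` *:%R s @^-1` A)).
  by apply: ppXi.2; exact: measurable_scale_preimage.
by apply/funext => w; exact: point_count_counting.
Qed.

Lemma point_count_ge0 A w : 0 <= point_count A w.
Proof. by apply: sumr_ge0 => x _; rewrite indicE. Qed.

Lemma integral_point_count A : A `<=` Omega -> measurable A ->
  (\int[P]_w (point_count A w)%:E = (c * L)%:E * lebesgue_rV n A)%E.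
Proof.
move=> AO mA; have mB := measurable_scale_preimage mA.
set B := _ @^-1` A in mB.
transitivity (\int[P]_w \esum_(x in Xi w) (\1_B x)%:E)%E.
  apply: eq_integral => w _; rewrite point_count_counting// -/B.
  have fB : finite_set (Xi w `&` B) by exact: finite_preimage_scale.
  rewrite /counting asboolT// -(finite_card_sum R fB) esum_mkcondr.
  by apply: eq_esum => x _; rewrite indicE; case: ifPn.
rewrite homXi; [|exact/measurable_EFinP/measurable_indic|by move=> x; rewrite lee_fin indicE].
rewrite integral_indic// setIT EFinM -muleA; congr (_ * _)%E.
by have := lebesgue_rV_scale s0 mA; rewrite sn.
Qed.

Section step_function.
Variables (S : finType) (cell : S -> set 'rV[R]_n) (vol : S -> R).
Hypotheses (mcell : forall k, measurable (cell k)) (tcell : trivIset setT cell)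
  (ccell : \bigcup_k cell k = Omega)
  (vcell : forall k, lebesgue_rV n (cell k) = (vol k)%:E).
Variable a : S -> R.

Definition linear_stat w : R := \sum_k a k * point_count (cell k) w.

Let f (x : 'rV[R]_n) : R := \sum_k a k * \1_(cell k) x.

Let cellO k : cell k `<=` Omega. Proof. by rewrite -ccell => x kx; exists k. Qed.

Let f_cell k x : cell k x -> f x = a k.
Proof.
move=> kx; rewrite /f (bigD1 k)//= big1 => [|l lk].
  by rewrite addr0 indicE mem_set// mulr1.
rewrite indicE memNset ?mulr0// => lx; move/eqP: lk; apply.
by apply: tcell => //; exists x.
Qed.

Let f_out x : ~ Omega x -> f x = 0.
Proof.
move=> Ox; rewrite /f big1// => k _.
by rewrite indicE memNset ?mulr0// => /cellO.
Qed.

Let fO : f \_ Omega = f.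
Proof.
by apply/funext => x; rewrite patchE; case: ifPn => // /negP; rewrite inE => /f_out.
Qed.

Let mf : measurable_fun setT f.
Proof.
by apply: measurable_sum => k; apply: measurable_funM.
Qed.

Lemma sum_dilation w : (\sum_(x \in dilation L Xi w) (f \_ Omega) x)%R = linear_stat w.
Proof.
rewrite fO; transitivity (\sum_(x \in dilation L Xi w `&` Omega) f x).
  by apply/esym/fsbig_widen => [x []//|x [Dx /not_andP[//|/f_out]]].
rewrite fsbig_finite//=; last exact: finite_dilation.
by rewrite exchange_big/=; apply: eq_bigr => k _; rewrite -mulr_sumr.
Qed.

Lemma measurable_linear_stat : measurable_fun setT linear_stat.
Proof.
apply: measurable_sum => k; apply: measurable_funM => //.
exact: measurable_point_count.
Qed.

Let integrable_point_count k : P.-integrable setT (EFin \o point_count (cell k)).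
Proof.
have mk := @measurable_point_count (cell k) (@cellO k) (mcell k).
apply/integrableP; split; first exact/measurable_EFinP.
under eq_integral do rewrite /= ger0_norm ?point_count_ge0//.
by rewrite integral_point_count// vcell -EFinM ltry.
Qed.

Lemma integral_linear_stat :
  (\int[P]_w (linear_stat w)%:E = (c * L * \sum_k a k * vol k)%:E)%E.
Proof.
transitivity (\int[P]_w (\sum_k (a k)%:E * (point_count (cell k) w)%:E))%E.
  by apply: eq_integral => w _; rewrite /linear_stat -sumEFin.
rewrite integral_sum//; last by move=> k; apply: integrableZl => //; exact: integrable_point_count.
rewrite mulr_sumr -sumEFin; apply: eq_bigr => k _.
rewrite integralZl//; last exact: integrable_point_count.
by rewrite integral_point_count// vcell -!EFinM; congr (_%:E); ring.
Qed.

Let integral_f2 : (\int[lebesgue_rV n]_x (f x ^+ 2)%:E = (\sum_k a k ^+ 2 * vol k)%:E)%E.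
Proof.
transitivity (\int[lebesgue_rV n]_x (\sum_k (a k ^+ 2)%:E * (\1_(cell k) x)%:E))%E.
  apply: eq_integral => x _; rewrite sumEFin; congr (_%:E).
  have [Ox|Ox] := pselect (Omega x).
    move: (Ox); rewrite -ccell => -[k _ kx]; rewrite (f_cell kx).
    rewrite (bigD1 k)//= big1 => [|l lk].
      by rewrite addr0 indicE mem_set// mulr1.
    rewrite indicE memNset ?mulr0// => lx; move/eqP: lk; apply.
    by apply: tcell => //; exists x.
  rewrite f_out// expr0n big1// => k _.
  by rewrite indicE memNset ?mulr0// => /cellO.
rewrite ge0_integral_sum//; last 2 first.
- by move=> k; apply: measurable_funeM; exact/measurable_EFinP/measurable_indic.
- by move=> k x _; rewrite mule_ge0// lee_fin ?sqr_ge0// indicE.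
rewrite -sumEFin; apply: eq_bigr => k _.
rewrite ge0_integralZl//; last 2 first.
- exact/measurable_EFinP/measurable_indic.
- by rewrite lee_fin sqr_ge0.
by rewrite integral_indic// setIT [RHS]EFinM -vcell.
Qed.

Let norm_f2 : ('N[lebesgue_rV n]_2%:E[EFin \o f] ^+ 2 = (\sum_k a k ^+ 2 * vol k)%:E)%E.
Proof.
have v0 k : 0 <= vol k by rewrite -lee_fin -vcell.
rewrite unlock.
rewrite (eq_integral (fun x => (f x ^+ 2)%:E)); last first.
  move=> x _; rewrite /=; congr (_%:E).
  by rewrite (powR_mulrn 2)// real_normK ?num_real.
rewrite integral_f2 poweR_EFin powR12_sqrt.
  by rewrite -EFin_expe sqr_sqrtr// sumr_ge0// => k _; rewrite mulr_ge0 ?sqr_ge0.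
by rewrite sumr_ge0// => k _; rewrite mulr_ge0 ?sqr_ge0.
Qed.

(** The variance hypothesis is applied to the step function with value [a k] on [cell k].
    Disjointness of the cells gives its squared norm, and the constant intensity gives the mean that
    is subtracted. *)
Lemma integral_sqr_linear_stat :
  (\int[P]_w ((linear_stat w - c * L * \sum_k a k * vol k) ^+ 2)%:E <=
   (C0 * L * \sum_k a k ^+ 2 * vol k)%:E)%E.
Proof.
have fL : f \_ Omega \in Lfun (lebesgue_rV n) 2%:E.
  rewrite fO inE; apply/andP; split; rewrite inE//=.
  rewrite /finite_norm ltNge; apply/negP; rewrite leye_eq => /eqP foo.
  by have := norm_f2; rewrite foo.
have := varXi fL; rewrite (_ : (fun w => _) = linear_stat); last first.
  by apply/funext => w; exact: sum_dilation.
rewrite fO norm_f2 -EFinM; apply: le_trans.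
rewrite /variance covariance.unlock expectation.unlock integral_linear_stat /=.
by rewrite le_eqVlt; apply/orP; left; apply/eqP/eq_integral => w _ /=; rewrite expr2.
Qed.

End step_function.

End linear_statistics.

(** * From couplings of cells to the Wasserstein distance *)

Section measure_seq_sum.
Local Open Scope ereal_scope.
Context d (T : measurableType d) (R : realType) (I : Type).
Variables (m : I -> {measure set T -> \bar R}) (i0 : I).

Lemma measure_seq_sum (s : seq I) : exists M : {measure set T -> \bar R},
  (forall A, M A = \sum_(i <- s) m i A) /\
  (forall f : T -> \bar R, measurable_fun setT f -> (forall x, 0 <= f x) ->
    \int[M]_x f x = \sum_(i <- s) \int[m i]_x f x).
Proof.
exists (msum (fun k => m (nth i0 s k)) (size s)); split=> [A|f mf f0].
  by rewrite (big_nth i0) big_mkord.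
by rewrite ge0_integral_measure_sum// (big_nth i0) big_mkord.
Qed.

End measure_seq_sum.

Section restricted_section_measure.
Local Open Scope ereal_scope.
Context {R : realType} {n : nat}.
Variables (nu : {measure set 'rV[R]_n -> \bar R}) (D : set 'rV[R]_n)
  (mD : measurable D) (y : 'rV[R]_n) (q : {nonneg R}).

(** This is [q] times the product of the Dirac mass at [y] with [nu] restricted to [D], obtained as
    an image under [pair y]. *)
Definition section_measure : {measure set ('rV[R]_n * 'rV[R]_n) -> \bar R} :=
  mscale q (image_measure (mrestr nu mD) (pair1_measurable y)).

Lemma section_measureE A : section_measure A = q%:num%:E * nu (pair y @^-1` A `&` D).
Proof. by []. Qed.

Lemma integral_section_measure_le (f : 'rV[R]_n * 'rV[R]_n -> \bar R) (K : R) :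
  measurable_fun setT f -> (forall z, 0 <= f z) ->
  (forall x, D x -> f (y, x) <= K%:E) ->
  \int[section_measure]_z f z <= q%:num%:E * (K%:E * nu D).
Proof.
move=> mf f0 fK; rewrite ge0_integral_mscale//.
apply: lee_wpmul2l; first by rewrite lee_fin.
have -> : \int[image_measure (mrestr nu mD) (pair1_measurable y)]_x f x =
    \int[mrestr nu mD]_x (f \o pair y) x.
  rewrite -[setT in RHS](preimage_setT (pair y)).
  exact: (ge0_integral_pushforward (pair1_measurable y) (mrestr nu mD) measurableT mf).
have mfy : measurable_fun setT (f \o pair y).
  by apply: measurableT_comp => //; exact: pair1_measurable.
have nN : mrestr nu mD (~` D) = 0 by rewrite /mrestr setICl measure0.
have f0y x : setT x -> 0 <= (f \o pair y) x by move=> _; exact: f0.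
rewrite (ge0_negligible_integral (measurableC mD) measurableT mfy f0y nN).
rewrite setTD setCK; apply: (@le_trans _ _ (\int[mrestr nu mD]_(x in D) (cst K%:E x))).
  apply: ge0_le_integral => //; first by move=> x _; exact: f0.
  exact: measurable_funS mfy.
have nuD : mrestr nu mD D = nu D by rewrite /mrestr setIid.
by rewrite integral_cst// -nuD.
Qed.

End restricted_section_measure.

Lemma measure_partition d (T : measurableType d) (R : realType) (S : finType)
    (nu : {measure set T -> \bar R}) (cell : S -> set T) (A : set T) :
  (forall k, measurable (cell k)) -> trivIset setT cell -> measurable A ->
  (\sum_k nu (A `&` cell k) = nu (A `&` \bigcup_k cell k))%E.
Proof.
move=> mcell tcell mA; rewrite setI_bigcupr content_fin_bigcup//.
- rewrite (fsbig_seq _ _ (index_enum_uniq S)); apply: eq_fsbigl.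
  by apply/seteqP; split=> k //= _; rewrite mem_index_enum.
- exact: finite_finset.
- by move=> k l _ _ [x [[_ kx] [_ lx]]]; apply: tcell => //; exists x.
- by move=> k _; exact: measurableI.
- apply: fin_bigcup_measurable => [|k _]; first exact: finite_finset.
  exact: measurableI.
Qed.

Section coupling_of_cells.
Context {R : realType} {n : nat} {S : finType}.
Variables (X : {fset 'rV[R]_n}) (D : set 'rV[R]_n) (nu : {measure set 'rV[R]_n -> \bar R}).
Variables (cell : S -> set 'rV[R]_n) (rho0 : S -> R) (pi kappa : S -> S -> R).
Hypotheses (X0 : #|` X| != 0%N) (XD : forall x, x \in X -> D x)
  (mcell : forall k, measurable (cell k)) (tcell : trivIset setT cell)
  (ccell : \bigcup_k cell k = D)
  (nucell : forall k, nu (cell k) = (rho0 k)%:E) (rho0_gt0 : forall k, 0 < rho0 k)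
  (nuD : forall A, measurable A -> nu (A `&` D) = nu A)
  (pic : discrete_coupling rho0
     (fun l => #|` X|%:R^-1 * \sum_(x <- X) \1_(cell l) x) pi)
  (kappaE : forall k l x y, cell k x -> cell l y -> enorm (y - x) ^+ 2 <= kappa k l).

Let N : R := #|` X|%:R.
Let M l : R := \sum_(x <- X) \1_(cell l) x.

Let N0 : N != 0. Proof. by rewrite pnatr_eq0. Qed.

(** The mass [pi k l] is spread as a product: proportionally to [nu] on the cell [k], and equally
    over the points of [X] in the cell [l]. The point is the first component of the resulting
    coupling, whereas [pi] has the volume first. *)
Lemma W2_le_cells :
  (W2 (empirical_measure X) nu <= (Num.sqrt (\sum_k \sum_l pi k l * kappa k l))%:E)%E.
Proof.
have [x0 x0X] : exists x, x \in X.
  by apply/fset0Pn; rewrite -cardfs_eq0.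
have XS x : x \in X -> exists k, cell k x.
  by move=> /XD; rewrite -ccell => -[k _]; exists k.
have [k0 _] := XS _ x0X.
pose lab y := odflt k0 [pick k | `[< cell k y >]].
have labE k y : cell k y -> lab y = k.
  move=> ky; rewrite /lab; case: pickP => [l /asboolP ly|/(_ k)]; last by rewrite asboolT.
  by apply: tcell => //; exists y.
have lab_cell y : y \in X -> cell (lab y) y.
  by move=> /XS[k ky]; rewrite (labE _ _ ky).
have ME l : M l = \sum_(y <- X) (lab y == l)%:R.
  rewrite /M !big_seq; apply: eq_bigr => y yX; rewrite indicE; congr (_%:R).
  congr nat_of_bool; apply/idP/eqP => [|<-]; first by rewrite inE => /labE.
  by rewrite inE; exact: lab_cell.
have sum_lab (F : S -> R) : \sum_(y <- X) F (lab y) = \sum_l F l * M l.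
  under [RHS]eq_bigr do rewrite ME mulr_sumr.
  rewrite [RHS]exchange_big/=; apply: eq_bigr => y _.
  rewrite (bigD1 (lab y))//= eqxx mulr1 big1 ?addr0// => l.
  by rewrite eq_sym => /negbTE ->; rewrite mulr0.
have [pi0 pirow picol] := pic.
(* A cell without points receives no mass, so the division by [M l] below is harmless. *)
have piM k l : M l = 0 -> pi k l = 0.
  move=> Ml; have := picol l; rewrite -/(M l) Ml mulr0 => /eqP.
  by rewrite psumr_eq0// => /allP /(_ k); rewrite mem_index_enum => /(_ isT)/eqP.
have M0 l : 0 <= M l by apply: sumr_ge0 => y _; rewrite indicE.
pose q k y := pi k (lab y) / (rho0 k * M (lab y)).
have q0 k y : 0 <= q k y by rewrite divr_ge0// mulr_ge0// ltW.
have sum_q (F : S -> R) k : \sum_(y <- X) q k y * F (lab y) =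
    (\sum_l pi k l * F l) / rho0 k.
  rewrite (sum_lab (fun l => pi k l / (rho0 k * M l) * F l)) mulr_suml.
  apply: eq_bigr => l _; have [Ml|Ml] := eqVneq (M l) 0.
    by rewrite piM// !mul0r.
  by field; rewrite Ml gt_eqF.
pose s := [seq (y, k) | y <- X, k <- index_enum S].
have [Th [ThE Thint]] := measure_seq_sum
  (fun p : 'rV[R]_n * S => section_measure nu (mcell p.2) p.1 (NngNum (q0 p.2 p.1)))
  (x0, k0) s.
have cover_sum A : measurable A -> (\sum_k nu (A `&` cell k) = nu A)%E.
  by move=> mA; rewrite measure_partition// ccell nuD.
have Th_coupling : coupling (empirical_measure X) nu Th.
  move=> A mA; split.
  - rewrite ThE big_allpairs/= /empirical_measure ge0_sume_distrr//.
    rewrite !big_seq; apply: eq_bigr => y yX.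
    have qsum : \sum_k q k y * rho0 k = N^-1.
      have My : M (lab y) != 0.
        rewrite gt_eqF// lt_neqAle M0 andbT eq_sym; apply/eqP => My.
        move/eqP: My; rewrite /M psumr_eq0; last by move=> z _; rewrite indicE.
        move=> /allP /(_ _ yX); rewrite indicE mem_set ?oner_eq0//.
        exact: lab_cell.
      transitivity (\sum_k pi k (lab y) / M (lab y)).
        by apply: eq_bigr => k _; rewrite /q; field; rewrite My gt_eqF.
      by rewrite -mulr_suml picol -/(M _) mulfK.
    rewrite diracE; have [yA|yA] := boolP (y \in A).
      rewrite mule1 -qsum -sumEFin; apply: eq_bigr => k _.
      rewrite section_measureE (_ : _ @^-1` _ = setT) ?setTI ?nucell//.
      by apply/seteqP; split=> x //= _; split=> //; rewrite inE in yA.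
    rewrite mule0 big1// => k _.
    rewrite section_measureE (_ : _ @^-1` _ = set0) ?set0I ?measure0 ?mule0//.
    by rewrite -subset0 => x /= [yA' _]; move/negP: yA; apply; rewrite inE.
  - rewrite ThE big_allpairs/= exchange_big/= -cover_sum//; apply: eq_bigr => k _.
    transitivity (\sum_(y <- X) (q k y)%:E * nu (A `&` cell k))%E.
      apply: eq_bigr => y _; rewrite section_measureE; congr (_ * nu (_ `&` _))%E.
      by apply/seteqP; split=> x //= [].
    rewrite -ge0_sume_distrl//; last by move=> y _; rewrite lee_fin.
    rewrite sumEFin (eq_bigr (fun y => q k y * 1)); last by move=> y _; rewrite mulr1.
    rewrite (sum_q (fun=> 1)) (eq_bigr (pi k)); last by move=> l _; rewrite mulr1.
    by rewrite pirow divff ?mul1e// gt_eqF.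
have cost : (\int[Th]_z (enorm (z.1 - z.2) ^+ 2)%:E <=
    (\sum_k \sum_l pi k l * kappa k l)%:E)%E.
  have mcost : measurable_fun setT (fun z : 'rV[R]_n * 'rV[R]_n => (enorm (z.1 - z.2) ^+ 2)%:E).
    apply/measurable_EFinP.
    have -> : (fun z : 'rV[R]_n * 'rV[R]_n => enorm (z.1 - z.2) ^+ 2) =
        (fun z => \sum_i (z.1 0 i - z.2 0 i) ^+ 2).
      apply/funext => z; rewrite /enorm sqr_sqrtr.
        by apply: eq_bigr => i _; rewrite !mxE.
      by apply: sumr_ge0 => i _; exact: sqr_ge0.
    apply: measurable_sum => i; apply: measurable_funX; apply: measurable_funB.
      exact: (measurableT_comp (measurable_coord i) measurable_fst).
    exact: (measurableT_comp (measurable_coord i) measurable_snd).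
  have cost0 (z : 'rV[R]_n * 'rV[R]_n) : (0 <= (enorm (z.1 - z.2) ^+ 2)%:E :> \bar R)%E.
    by rewrite lee_fin sqr_ge0.
  rewrite (Thint _ mcost cost0) big_allpairs/=.
  apply: (@le_trans _ _ (\sum_(y <- X) \sum_k (q k y * (kappa k (lab y) * rho0 k))%:E)%E).
    rewrite !big_seq; apply: lee_sum => y yX; apply: lee_sum => k _.
    rewrite [leRHS]EFinM (EFinM (kappa _ _)) -nucell; apply: integral_section_measure_le => // x kx.
    by rewrite lee_fin; apply: kappaE => //; exact: lab_cell.
  rewrite exchange_big/=.
  under eq_bigr do rewrite sumEFin.
  rewrite sumEFin lee_fin; apply: ler_sum => k _.
  rewrite (eq_bigr (fun y => q k y * kappa k (lab y) * rho0 k)); last first.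
    by move=> y _; rewrite mulrA.
  by rewrite -mulr_suml (sum_q (kappa k)) divfK// gt_eqF.
apply: (@le_trans _ _ (sqrte (\int[Th]_z (enorm (z.1 - z.2) ^+ 2)%:E))).
  rewrite lee_sqrt; last by apply: integral_ge0 => z _; rewrite lee_fin sqr_ge0.
  by apply: ge_ereal_inf; exists (\int[Th]_z (enorm (z.1 - z.2) ^+ 2)%:E)%E => //; exists Th.
rewrite -[leRHS]/(sqrte (_%:E)) lee_sqrt//.
by apply: le_trans cost; apply: integral_ge0 => z _; rewrite lee_fin sqr_ge0.
Qed.

End coupling_of_cells.

Lemma enorm_sqr_le {R : realType} n (v : 'rV[R]_n) : enorm v ^+ 2 <= n%:R * `|v| ^+ 2.
Proof.
rewrite /enorm sqr_sqrtr; last by apply: sumr_ge0 => i _; exact: sqr_ge0.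
apply: (@le_trans _ _ (\sum_(i < n) `|v| ^+ 2)).
  by apply: ler_sum => i _; rewrite -[leLHS]real_normK ?num_real// lerXn2r ?nnegrE ?coord_le_norm.
by rewrite sumr_const card_ord [n%:R * _]mulr_natl.
Qed.

Section matching_bounds.
Context {R : realType} {n : nat} {S : finType} (Omega : set 'rV[R]_n).
Variables (cell : S -> set 'rV[R]_n) (pt : S -> 'rV[R]_n) (vol : S -> R) (h : R).
Hypotheses (mcell : forall k, measurable (cell k)) (tcell : trivIset setT cell)
  (ccell : \bigcup_k cell k = Omega)
  (vcell : forall k, lebesgue_rV n (cell k) = (vol k)%:E) (vol_gt0 : forall k, 0 < vol k)
  (cell_pt : forall k x, cell k x -> `|x - pt k| <= h).
Variables (mO : measurable Omega) (X : {fset 'rV[R]_n}).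
Hypotheses (X0 : #|` X| != 0%N) (XO : forall x, x \in X -> Omega x).

Let V := \sum_k vol k.

Let cellO k : cell k `<=` Omega. Proof. by rewrite -ccell => x kx; exists k. Qed.

Lemma lebesgue_cells : lebesgue_rV n Omega = V%:E.
Proof.
have := measure_partition (lebesgue_rV n) mcell tcell mO.
rewrite ccell setIid => <-; rewrite -sumEFin; apply: eq_bigr => k _.
by rewrite -vcell; congr (lebesgue_rV n _); exact/setIidPr/cellO.
Qed.

Let V0 : 0 < V.
Proof.
have [x xX] : exists x, x \in X by apply/fset0Pn; rewrite -cardfs_eq0.
have := XO xX; rewrite -ccell => -[k _ _].
by rewrite /V (bigD1 k)//= ltr_wpDr// sumr_ge0// => l _; exact: ltW.
Qed.

Definition cell_volume k : R := vol k / V.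
Definition cell_mass l : R := #|` X|%:R^-1 * \sum_(x <- X) \1_(cell l) x.

Lemma cell_volume_gt0 k : 0 < cell_volume k.
Proof. by rewrite divr_gt0. Qed.

Lemma cell_mass_ge0 k : 0 <= cell_mass k.
Proof. by rewrite mulr_ge0// sumr_ge0// => x _; rewrite indicE. Qed.

Lemma sum_cell_volume : \sum_k cell_volume k = 1.
Proof. by rewrite -mulr_suml divff// gt_eqF. Qed.

Lemma sum_cell_mass : \sum_k cell_mass k = 1.
Proof.
rewrite -mulr_sumr exchange_big/= (eq_big_seq (fun=> 1)) => [|x xX].
  rewrite big_const_seq count_predT iter_addr addr0.
  by rewrite mulVf// pnatr_eq0.
have := XO xX; rewrite -ccell => -[k _ kx]; rewrite (bigD1 k)//= big1 => [|l lk].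
  by rewrite addr0 indicE mem_set.
rewrite indicE memNset// => lx; move/eqP: lk; apply.
by apply: tcell => //; exists x.
Qed.

Lemma W2_le_discrete pi kappa : discrete_coupling cell_volume cell_mass pi ->
  (forall k l x y, cell k x -> cell l y -> enorm (y - x) ^+ 2 <= kappa k l) ->
  (W2 (empirical_measure X) (normalized_volume mO)
    <= (Num.sqrt (\sum_k \sum_l pi k l * kappa k l))%:E)%E.
Proof.
move=> pic kE; apply: (W2_le_cells (rho0 := cell_volume) X0 XO mcell tcell ccell) => //.
- move=> k; rewrite /= /normalized_volume lebesgue_cells/=.
  rewrite (setIidl (@cellO k)) vcell -EFinM; congr (_%:E).
  by rewrite mulrC.
- exact: cell_volume_gt0.
- by move=> A mA; rewrite /= /normalized_volume -setIA setIid.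
Qed.

(** Any coupling will do; the product of the two cell laws is used. *)
Lemma W2_le_diameter B : 0 <= B ->
  (forall x y, Omega x -> Omega y -> enorm (y - x) <= B) ->
  (W2 (empirical_measure X) (normalized_volume mO) <= B%:E)%E.
Proof.
move=> B0 hB; have pic : discrete_coupling cell_volume cell_mass
    (fun k l => cell_volume k * cell_mass l).
  split=> [k l|k|l].
  - by rewrite mulr_ge0 ?cell_mass_ge0// ltW// cell_volume_gt0.
  - by rewrite -mulr_sumr sum_cell_mass mulr1.
  - by rewrite -mulr_suml sum_cell_volume mul1r.
apply: (le_trans (W2_le_discrete (kappa := fun _ _ => B ^+ 2) pic _)).
  move=> k l x y /cellO Ox /cellO Oy.
  by rewrite lerXn2r ?nnegrE ?sqrtr_ge0// hB.
rewrite lee_fin; under eq_bigr do rewrite -mulr_suml -mulr_sumr sum_cell_mass mulr1.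
by rewrite -mulr_suml sum_cell_volume mul1r sqrtr_sqr ger0_norm.
Qed.

(** Replacing both end points by the representatives [pt] of their cells moves each coordinate by at
    most [h]. The square of a sum of three terms is at most three times the sum of squares, whence
    [6 * h ^+ 2] and the factor 3. *)
Lemma W2_le_coord_cost pi c : 0 <= h -> discrete_coupling cell_volume cell_mass pi ->
  (forall i, coord_cost (fun (i : 'I_n) k => pt k 0 i) pi i <= c) ->
  (W2 (empirical_measure X) (normalized_volume mO)
    <= (Num.sqrt (n%:R * (6 * h ^+ 2 + 3 * c)))%:E)%E.
Proof.
move=> h0 pic cpi.
pose kappa k l := \sum_(i < n) (6 * h ^+ 2 + 3 * (pt k 0 i - pt l 0 i) ^+ 2).
apply: (le_trans (W2_le_discrete (kappa := kappa) pic _)).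
  move=> k l x y kx ly; rewrite /enorm sqr_sqrtr; last first.
    by apply: sumr_ge0 => i _; exact: sqr_ge0.
  apply: ler_sum => i _.
  have := le_trans (coord_le_norm (x - pt k) i) (cell_pt kx).
  have := le_trans (coord_le_norm (y - pt l) i) (cell_pt ly).
  rewrite !mxE !ler_norml.
  set p := x 0 i; set q := y 0 i; set p' := pt k 0 i; set q' := pt l 0 i.
  move=> /andP[q1 q2] /andP[p1 p2].
  have a2 : (q - q') ^+ 2 <= h ^+ 2 by nra.
  have b2 : (p - p') ^+ 2 <= h ^+ 2 by nra.
  have -> : q - p = (q - q') - (p' - q') - (p - p') by ring.
  set u := q - q' in a2 *; set v := p' - q'; set w := p - p' in b2 *.
  have : 0 <= (u + v) ^+ 2 by exact: sqr_ge0.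
  have : 0 <= (u + w) ^+ 2 by exact: sqr_ge0.
  have : 0 <= (v - w) ^+ 2 by exact: sqr_ge0.
  by nra.
rewrite lee_fin ler_wsqrtr//.
have [pi0 pirow picol] := pic.
rewrite (eq_bigr (fun k => \sum_(i < n) (6 * h ^+ 2 * cell_volume k
    + 3 * \sum_l pi k l * (pt k 0 i - pt l 0 i) ^+ 2))); last first.
  move=> k _; under eq_bigr do rewrite mulr_sumr.
  rewrite exchange_big/=; apply: eq_bigr => i _.
  rewrite -pirow !mulr_sumr -big_split/=; apply: eq_bigr => l _; ring.
rewrite exchange_big/=.
apply: (@le_trans _ _ (\sum_(i < n) (6 * h ^+ 2 + 3 * c))).
  apply: ler_sum => i _; rewrite big_split/= -!mulr_sumr sum_cell_volume mulr1.
  by rewrite lerD2l ler_pM2l//; exact: cpi.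
by rewrite sumr_const card_ord [n%:R * _]mulr_natl.
Qed.

End matching_bounds.

(** * Expected matching error *)

Section nonmeasurable_comparison.
Import HBNNSimple.

(** The integral of a nonnegative function is a supremum over the simple functions below it, hence
    monotone for arbitrary functions. This covers [W2_error], whose measurability in [w] is never
    established. *)
Lemma le_integral_of_le d (T : measurableType d) (R : realType)
    (mu : {measure set T -> \bar R}) (f g : T -> \bar R) :
  (forall x, 0 <= f x)%E -> (forall x, f x <= g x)%E ->
  (\int[mu]_x f x <= \int[mu]_x g x)%E.
Proof.
move=> f0 fg; have g0 x : (0 <= g x)%E by exact: le_trans (f0 x) (fg x).
rewrite !ge0_integralTE//; apply: ge_ereal_sup => _ [h /= hf <-].
apply: le_ereal_sup_tmp; exists (sintegral mu h) => //; exists h => //= x.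
exact: le_trans (hf x) (fg x).
Qed.

End nonmeasurable_comparison.

Section quadratic_integral.
Context d (T : measurableType d) (R : realType) (P : probability T R).
Local Open Scope ereal_scope.

Lemma integral_quadratic_le (J : finType) (Z : J -> T -> R) (Y : T -> R)
    (a0 b g : R) (E : R) (EY : R) :
  (0 <= a0)%R -> (0 <= b)%R -> (0 <= g)%R ->
  (forall j, measurable_fun setT (Z j)) -> measurable_fun setT Y ->
  (forall j, \int[P]_w (Z j w ^+ 2)%:E <= E%:E) ->
  \int[P]_w (Y w ^+ 2)%:E <= EY%:E ->
  \int[P]_w (a0 + b * (\sum_j Z j w ^+ 2) + g * Y w ^+ 2)%:E <=
    (a0 + b * (#|J|%:R * E) + g * EY)%:E.
Proof.
move=> a00 b0 g0 mZ mY hZ hY.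
have mZ2 j : measurable_fun setT (fun w => (Z j w ^+ 2)%:E).
  by apply/measurable_EFinP; exact: measurable_funX.
have mY2 : measurable_fun setT (fun w => (Y w ^+ 2)%:E).
  by apply/measurable_EFinP; exact: measurable_funX.
have mS : measurable_fun setT (fun w => \sum_j (Z j w ^+ 2)%:E).
  exact: emeasurable_sum.
have S0 w : 0 <= \sum_j (Z j w ^+ 2)%:E by apply: sume_ge0 => j _; rewrite lee_fin sqr_ge0.
rewrite (eq_integral (fun w => (a0%:E + b%:E * \sum_j (Z j w ^+ 2)%:E) + g%:E * (Y w ^+ 2)%:E));
  last by move=> w _; rewrite sumEFin -!EFinM -!EFinD.
rewrite ge0_integralD//; last 4 first.
- by move=> w _; rewrite adde_ge0 ?lee_fin// mule_ge0.
- by apply: emeasurable_funD => //; exact: measurable_funeM.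
- by move=> w _; rewrite mule_ge0 ?lee_fin// sqr_ge0.
- exact: measurable_funeM.
rewrite ge0_integralD//; last 2 first.
- by move=> w _; rewrite mule_ge0.
- exact: measurable_funeM.
have -> : \int[P]_x a0%:E = a0%:E.
  by rewrite -[RHS]mule1 -(probability_setT P) -integral_cst.
rewrite ge0_integralZl//.
rewrite ge0_integralZl//; last by move=> w _; rewrite lee_fin sqr_ge0.
rewrite ge0_integral_sum//; last by move=> j w _; rewrite lee_fin sqr_ge0.
rewrite EFinD EFinD !EFinM; apply: leeD; last by rewrite lee_wpmul2l.
apply: leeD => //; apply: lee_wpmul2l => //.
apply: (@le_trans _ _ (\sum_(j : J) E%:E)); first exact: lee_sum.
by rewrite sumEFin sumr_const -EFinM lee_fin mulr_natl.
Qed.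

End quadratic_integral.

Section expected_matching_error.
Context disp {T : measurableType disp} {R : realType} (P : probability T R) {n : nat}.
Variables (Xi : T -> set 'rV[R]_n) (Omega : set 'rV[R]_n) (L c C0 : R).
Hypotheses (n1 : (1 < n)%N) (ppXi : point_process Xi)
  (oOmega : open Omega) (bOmega : bounded_set Omega) (Omega0 : Omega !=set0)
  (L0 : 0 < L) (c0 : 0 < c) (C00 : 0 < C0).
Hypothesis homXi : forall f : 'rV[R]_n -> \bar R, measurable_fun setT f ->
  (forall x, 0 <= f x)%E ->
  (\int[P]_w (\esum_(x in Xi w) f x) = c%:E * \int[lebesgue_rV n]_x f x)%E.
Hypothesis varXi : forall f : 'rV[R]_n -> R, f \_ Omega \in Lfun (lebesgue_rV n) 2%:E ->
  ('V_P[fun w => (\sum_(x \in dilation L Xi w) (f \_ Omega) x)%R]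
   <= (C0 * L)%:E * 'N[lebesgue_rV n]_2%:E[EFin \o f \_ Omega] ^+ 2)%E.
Variable K : nat.
Local Notation S := {ffun 'I_n -> 'I_(2 ^ K)}.
Variables (cell : S -> set 'rV[R]_n) (pt : S -> 'rV[R]_n) (vol : S -> R) (h v0 v1 B : R).
Hypotheses (mcell : forall k, measurable (cell k)) (tcell : trivIset setT cell)
  (ccell : \bigcup_k cell k = Omega)
  (vcell : forall k, lebesgue_rV n (cell k) = (vol k)%:E)
  (v00 : 0 < v0) (vol_ge : forall k, v0 <= vol k) (vol_le : forall k, vol k <= v1)
  (h0 : 0 < h) (cell_pt : forall k x, cell k x -> `|x - pt k| <= h)
  (next_pt : forall i k l, next_cell i k l -> `|pt k - pt l| <= h)
  (B0 : 0 <= B) (diamB : forall x y, Omega x -> Omega y -> enorm (y - x) <= B).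

Let V := \sum_k vol k.
Let mO : measurable Omega := measurable_open_rV oOmega.
Let n0 : (0 < n)%N. Proof. exact: ltnW. Qed.

Let vol_gt0 k : 0 < vol k. Proof. exact: lt_le_trans (vol_ge k). Qed.

Let V0 : 0 < V.
Proof.
have [x] := Omega0; rewrite -ccell => -[k _ _].
by rewrite /V (bigD1 k)//= ltr_wpDr// sumr_ge0// => l _; exact: ltW.
Qed.

Let cellO k : cell k `<=` Omega. Proof. by rewrite -ccell => x kx; exists k. Qed.

(** The index [p] is a cell, a direction and a side, that is, a face. Subtracting the volume average
    makes the linear statistic mean-zero and accounts exactly for the normalisation by the random
    [N], see [face_fluxE]. *)
Definition centered_kernel (p : S * 'I_n * bool) (x : S) : R :=
  grid_kernel p.1.2 (p.1.1 p.1.2 + p.2) p.1.1 x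
  - \sum_y grid_kernel p.1.2 (p.1.1 p.1.2 + p.2) p.1.1 y * (vol y / V).

Let Z p := linear_stat Xi Omega L cell (centered_kernel p).
Let N := linear_stat Xi Omega L cell (fun=> 1).
Let EN := c * L * V.
Let EN0 : 0 < EN. Proof. by rewrite !mulr_gt0. Qed.

Let sum_centered_kernel p : \sum_x centered_kernel p x * vol x = 0.
Proof.
rewrite /centered_kernel; under eq_bigr do rewrite mulrBl.
rewrite sumrB -mulr_sumr -/V mulr_suml.
apply/eqP; rewrite subr_eq0; apply/eqP; apply: eq_bigr => x _.
by rewrite -mulrA divfK// gt_eqF.
Qed.

Let sum_sqr_centered_kernel p : \sum_x centered_kernel p x ^+ 2 * vol x <=
  v1 * (4 * 2 ^+ n * \sum_(k < K) (4 / 2 ^+ n) ^+ k).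
Proof.
have bn : (p.1.1 p.1.2 <= p.1.1 p.1.2 + p.2 <= (p.1.1 p.1.2).+1)%N.
  by rewrite leq_addr; case: p.2 => /=; rewrite ?addn0 ?addn1 ?leqnSn.
apply: (@le_trans _ _ (v1 * \sum_x grid_kernel p.1.2 (p.1.1 p.1.2 + p.2) p.1.1 x ^+ 2)).
  rewrite mulr_sumr.
  apply: (@le_trans _ _ (\sum_x grid_kernel p.1.2 (p.1.1 p.1.2 + p.2) p.1.1 x ^+ 2 * vol x)).
    (* Centring is an orthogonal projection for the weights [vol], so it does not increase the
       weighted sum of squares. *)
    pose k x : R := grid_kernel p.1.2 (p.1.1 p.1.2 + p.2) p.1.1 x.
    pose kb := \sum_y k y * (vol y / V).
    have k0 : \sum_x (k x - kb) * vol x = 0 := sum_centered_kernel p.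
    suff : \sum_x (k x - kb) ^+ 2 * vol x <= \sum_x k x ^+ 2 * vol x by [].
    rewrite -subr_ge0 -sumrB (eq_bigr (fun x => 2 * kb * ((k x - kb) * vol x) + kb ^+ 2 * vol x)).
      by rewrite big_split/= -!mulr_sumr k0 mulr0 add0r mulr_ge0 ?sqr_ge0// ltW.
    by move=> x _; ring.
  by apply: ler_sum => x _; rewrite mulrC ler_wpM2r ?sqr_ge0.
rewrite ler_wpM2l//; first by rewrite (le_trans _ (vol_le p.1.1))// ltW.
exact: sum_sqr_grid_kernel.
Qed.

Let pointsO w x : x \in points Xi Omega L w -> Omega x.
Proof.
rewrite in_fset_set; first by rewrite inE => -[].
exact: (finite_dilation ppXi bOmega L0 w (@subset_refl _ _)).
Qed.

Let NE w : N w = #|` points Xi Omega L w|%:R.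
Proof.
rewrite /N /linear_stat; under eq_bigr do rewrite mul1r.
rewrite -(@point_countE _ _ _ _ _ _ _ ppXi bOmega L0 Omega w (@subset_refl _ _)).
rewrite /point_count exchange_big/= [LHS]big_seq [RHS]big_seq; apply: eq_bigr => x xX.
have Ox := pointsO xX; rewrite indicE mem_set//; move: Ox; rewrite -ccell => -[k _ kx].
rewrite (bigD1 k)//= big1 => [|l lk]; first by rewrite addr0 indicE mem_set.
rewrite indicE memNset// => lx; move/eqP: lk; apply.
by apply: tcell => //; exists x.
Qed.

Let face_fluxE w (b : S) i s : #|` points Xi Omega L w| != 0%N ->
  face_flux (fun y => cell_volume vol y - cell_mass cell (points Xi Omega L w) y) s i b
  = - (Z (b, i, s) w / N w).
Proof.
move=> X0; rewrite /face_flux /Z /linear_stat.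
have Nw0 : N w != 0 by rewrite NE pnatr_eq0.
rewrite (eq_bigr (fun x => grid_kernel i (b i + s) b x * (vol x / V)
   - grid_kernel i (b i + s) b x * (point_count Xi Omega L (cell x) w / N w))); last first.
  move=> x _; rewrite mulrBr /cell_mass -NE -/(point_count Xi Omega L (cell x) w).
  by rewrite /cell_volume [(N w)^-1 * _]mulrC.
rewrite sumrB /centered_kernel /=.
set kb := \sum_y _ * (vol y / V).
under [in RHS]eq_bigr do rewrite mulrBl.
rewrite sumrB -mulr_sumr.
have -> : \sum_x point_count Xi Omega L (cell x) w = N w.
  by apply: eq_bigr => x _; rewrite mul1r.
rewrite mulrBl mulfK// opprB; congr (_ - _).
by rewrite mulr_suml; apply: eq_bigr => x _; rewrite mulrA.
Qed.

(** The tangent to the square root at [r ^+ 2]: it makes the bound on [W2] affine in quantities of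
    known expectation. In the end [r] is the rate itself. *)
Let sqrt_amgm (D r : R) : 0 <= D -> 0 < r -> Num.sqrt D <= D / (2 * r) + r / 2.
Proof.
move=> D0 r0; rewrite -{2}(sqr_sqrtr D0) -subr_ge0.
have -> : Num.sqrt D ^+ 2 / (2 * r) + r / 2 - Num.sqrt D = (Num.sqrt D - r) ^+ 2 / (2 * r).
  by field; rewrite gt_eqF.
by rewrite divr_ge0 ?sqr_ge0// mulr_ge0// ltW.
Qed.

(** The coupling costs [6 + 3 * 52 = 162] times [n%:R * h ^+ 2] before the flux term; the division
    by [2 * r] in [sqrt_amgm] leaves 81. *)
Definition error_constant r := 81 * n%:R * h ^+ 2 / r.

(** A pointwise Chebyshev argument. If [N w <= EN / 2], which includes the case of no points, the
    error is at most [B], and [(N w - EN) ^+ 2] is at least [EN ^+ 2 / 4]. Otherwise the transport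
    bound applies, with [1 / N w ^+ 2] at most [4 / EN ^+ 2]. *)
Lemma W2_error_le r w : 0 < r ->
  (W2_error mO (dilation L Xi w) <= (r / 2 + error_constant r
    + error_constant r * (2 * n%:R * V / v0) * (4 / EN ^+ 2) * (\sum_p Z p w ^+ 2)
    + 4 * B / EN ^+ 2 * (N w - EN) ^+ 2)%:E)%E.
Proof.
move=> r0.
have e0 : 0 <= error_constant r by rewrite divr_ge0 ?mulr_ge0 ?sqr_ge0// ltW.
have k0 : 0 <= 2 * n%:R * V / v0 by rewrite divr_ge0 ?mulr_ge0 ?(ltW V0)// ltW.
have q0 : 0 <= \sum_p Z p w ^+ 2 by apply: sumr_ge0 => p _; exact: sqr_ge0.
have t0 : 0 <= error_constant r * (2 * n%:R * V / v0) * (4 / EN ^+ 2) * (\sum_p Z p w ^+ 2).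
  by rewrite mulr_ge0// mulr_ge0 ?divr_ge0 ?sqr_ge0// mulr_ge0.
have r20 : 0 <= r / 2 by rewrite divr_ge0// ltW.
have small : N w <= EN / 2 -> B <= 4 * B / EN ^+ 2 * (N w - EN) ^+ 2.
  move=> NEN; have EN2 : (EN / 2) ^+ 2 <= (N w - EN) ^+ 2.
    rewrite -[leRHS]sqrrN opprB lerXn2r ?nnegrE//; [| |by lra].
      by rewrite divr_ge0// ltW.
    by have := EN0; lra.
  apply: (@le_trans _ _ (4 * B / EN ^+ 2 * (EN / 2) ^+ 2)).
    by rewrite le_eqVlt; apply/orP; left; apply/eqP; field; rewrite gt_eqF.
  by rewrite ler_wpM2l// divr_ge0 ?sqr_ge0// mulr_ge0.
rewrite /W2_error -/(points Xi Omega L w).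
case: ifPn => [X0|X0].
  apply: (@le_trans _ _ B%:E).
    by apply: ge_ereal_sup => _ [[x y] [/= Ox Oy]] <-; rewrite lee_fin diamB.
  rewrite lee_fin; apply: (le_trans (small _)).
    by rewrite NE (eqP X0) divr_ge0// ltW.
  by rewrite lerDr addr_ge0// addr_ge0.
have [NEN|NEN] := leP (N w) (EN / 2).
  apply: (le_trans (W2_le_diameter mcell tcell ccell vcell vol_gt0 mO X0 (@pointsO w) B0 diamB)).
  by rewrite lee_fin (le_trans (small NEN))// lerDr addr_ge0// addr_ge0.
have rho_ge k : v0 / V <= cell_volume vol k by rewrite ler_pM2r ?invr_gt0.
have h_next i (b k : S) l : next_cell i b k -> `|pt b 0 l - pt k 0 l| <= h.
  move=> /next_pt; apply: le_trans.
  by have := coord_le_norm (pt b - pt k) l; rewrite !mxE.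
have [pi pic cpi] := grid_transport (x := fun (i : 'I_n) k => pt k 0 i) h0 (divr_gt0 v00 V0) rho_ge
  (cell_mass_ge0 cell (points Xi Omega L w)) (sum_cell_volume ccell vol_gt0 X0 (@pointsO w))
  (sum_cell_mass tcell ccell X0 (@pointsO w)) h_next.
apply: (le_trans (W2_le_coord_cost mcell tcell ccell vcell vol_gt0 cell_pt mO X0
  (@pointsO w) (ltW h0) pic cpi)).
rewrite lee_fin.
set Q := \sum_b _.
have QE : Q = (\sum_p Z p w ^+ 2) / N w ^+ 2.
  rewrite /Q; under eq_bigr => b _ do
    under eq_bigr => i _ do under eq_bigr => s _ do rewrite face_fluxE// sqrrN expr_div_n.
  under eq_bigr => b _ do rewrite pair_bigA/=.
  rewrite pair_bigA/= mulr_suml (reindex (fun p : S * ('I_n * bool) => (p.1, p.2.1, p.2.2)))//=.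
  by exists (fun p : S * 'I_n * bool => (p.1.1, (p.1.2, p.2))) => [[b [i s]]|[[b i] s]].
have N0 : 0 < N w by apply: le_lt_trans NEN; rewrite divr_ge0// ltW.
have Q0 : 0 <= Q by rewrite QE divr_ge0// sqr_ge0.
have QE4 : Q <= 4 / EN ^+ 2 * (\sum_p Z p w ^+ 2).
  rewrite QE mulrC ler_wpM2r//.
  rewrite -[leRHS]invrK invf_div lef_pV2 ?posrE ?divr_gt0 ?exprn_gt0//.
  have -> : EN ^+ 2 / 4 = (EN / 2) ^+ 2 by field.
  by rewrite lerXn2r ?nnegrE ?divr_ge0 ?(ltW EN0) ?(ltW N0) ?(ltW NEN).
set k := 2 * n%:R * V / v0 in k0 t0 *.
have kE : 2 * n%:R / (v0 / V) = k by rewrite /k; field; rewrite !gt_eqF.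
rewrite kE; set D := n%:R * _.
have h20 : 0 <= h ^+ 2 by exact: sqr_ge0.
have DE : D = n%:R * h ^+ 2 * (162 + 156 * (k * Q)) by rewrite /D; ring.
have D0 : 0 <= D.
  rewrite DE; apply: mulr_ge0; first by rewrite mulr_ge0.
  by rewrite addr_ge0// mulr_ge0// mulr_ge0.
apply: (le_trans (sqrt_amgm D0 r0)).
have y0 : 0 <= 4 * B / EN ^+ 2 * (N w - EN) ^+ 2.
  by rewrite mulr_ge0 ?sqr_ge0// divr_ge0 ?sqr_ge0// mulr_ge0.
suff : D / (2 * r) <= error_constant r
    + error_constant r * k * (4 / EN ^+ 2) * (\sum_p Z p w ^+ 2) by lra.
have -> : D / (2 * r) = error_constant r * (1 + 156 / 162 * (k * Q)).
  by rewrite DE /error_constant; field; rewrite gt_eqF.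
rewrite mulrDr mulr1 lerD2l -[leRHS]mulrA.
have -> : error_constant r * (156 / 162 * (k * Q)) = error_constant r * k * (156 / 162 * Q).
  by ring.
by apply: ler_wpM2l; [rewrite mulr_ge0|lra].
Qed.

Lemma expected_W2_error_le r : 0 < r ->
  (\int[P]_w W2_error mO (dilation L Xi w) <=
   (r / 2 + error_constant r
    + error_constant r * (2 * n%:R * V / v0) * (4 / EN ^+ 2) *
      (((2 ^ K) ^ n * n * 2)%:R *
         (C0 * L * (v1 * (4 * 2 ^+ n * \sum_(k < K) (4 / 2 ^+ n) ^+ k))))
    + 4 * B / EN ^+ 2 * (C0 * L * V))%:E)%E.
Proof.
move=> r0.
have e0 : 0 <= error_constant r by rewrite divr_ge0 ?mulr_ge0 ?sqr_ge0// ltW.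
apply: (@le_trans _ _ (\int[P]_w (r / 2 + error_constant r
    + error_constant r * (2 * n%:R * V / v0) * (4 / EN ^+ 2) * (\sum_p Z p w ^+ 2)
    + 4 * B / EN ^+ 2 * (N w - EN) ^+ 2)%:E)%E).
  apply: le_integral_of_le => w; last exact: W2_error_le.
  rewrite /W2_error; case: ifPn => [/eqP X0|_]; last by rewrite /W2 sqrte_ge0.
  have [x Ox] := Omega0; apply: ereal_sup_ubound; exists (x, x) => //=.
  by rewrite subrr /enorm big1 ?sqrtr0// => i _; rewrite mxE expr0n.
have -> : ((2 ^ K) ^ n * n * 2)%N = #|{: S * 'I_n * bool}|.
  by rewrite !card_prod card_ffun !card_ord card_bool.
have ms a : measurable_fun setT (linear_stat Xi Omega L cell a).
  exact: measurable_linear_stat.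
have EZ p := integral_sqr_linear_stat n0 ppXi bOmega L0 homXi varXi mcell tcell ccell vcell
  (centered_kernel p).
have EN1 := integral_sqr_linear_stat n0 ppXi bOmega L0 homXi varXi mcell tcell ccell vcell
  (fun=> 1).
apply: integral_quadratic_le => //.
- by rewrite addr_ge0// divr_ge0// ltW.
- apply: mulr_ge0; last by rewrite divr_ge0 ?sqr_ge0.
  by rewrite mulr_ge0// divr_ge0 ?(ltW v00)// mulr_ge0// ltW.
- by rewrite divr_ge0 ?sqr_ge0// mulr_ge0.
- by move=> p; exact: ms.
- by apply: measurable_funB => //; exact: ms.
- move=> p; have := EZ p; rewrite sum_centered_kernel mulr0.
  under eq_integral do rewrite subr0.
  move=> /le_trans; apply; rewrite lee_fin ler_wpM2l ?mulr_ge0 ?(ltW C00) ?(ltW L0)//.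
- move: EN1; have -> : \sum_k 1 * vol k = V by apply: eq_bigr => k _; rewrite mul1r.
  by have -> : \sum_k 1 ^+ 2 * vol k = V by apply: eq_bigr => k _; rewrite expr1n mul1r.
Qed.

End expected_matching_error.

(** * The dyadic scale and the rate of convergence *)

Section rate.
Context {R : realType}.

Lemma dyadic_scale (d : nat) (L : R) : (0 < d)%N -> 1 <= L ->
  exists K : nat, ((2 : R) ^+ K) ^+ d <= L < (2 ^+ K.+1) ^+ d.
Proof.
move=> d0 L1; have L0 : 0 <= L by lra.
have /andP[tL Lt] := truncn_itv L0; set N := Num.truncn L in tL Lt.
have N0 : (0 < N)%N by rewrite truncn_gt0.
have p1 : (1 < 2 ^ d)%N by rewrite -(expn0 2) ltn_exp2l.
exists (trunc_log (2 ^ d) N).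
have pE k : (2 ^+ k) ^+ d = ((2 ^ d) ^ k)%:R :> R by rewrite !natrX -!exprM mulnC.
rewrite !pE; apply/andP; split.
  by apply: le_trans tL; rewrite ler_nat trunc_logP.
by apply: (lt_le_trans Lt); rewrite ler_nat trunc_log_ltn.
Qed.

Definition matching_rate (d : nat) (L : R) : R :=
  if d == 2%N then Num.sqrt (ln L) / Num.sqrt L else (L `^ d%:R^-1)^-1.

Lemma matching_rate_gt0 d L : 2 <= L -> 0 < matching_rate d L.
Proof.
move=> L2; rewrite /matching_rate; case: ifPn => _.
  by rewrite divr_gt0// sqrtr_gt0 ?ln_gt0//; lra.
by rewrite invr_gt0 powR_gt0//; lra.
Qed.

(** The ratio [4 / 2 ^+ d] is 1 for [d = 2], where the sum equals [K], of order [ln L], and at most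
    [1 / 2] otherwise, where the sum is at most 2. The second bound is for the term coming from the
    variance of [N]. *)
Lemma matching_rate_ge (d : nat) : (2 <= d)%N ->
  exists2 C : R, 1 <= C & forall (L : R) (K : nat), 2 <= L ->
    (2 ^+ K) ^+ d <= L < (2 ^+ K.+1) ^+ d ->
    (1 + \sum_(k < K) (4 / 2 ^+ d) ^+ k) / (2 ^+ K) ^+ 2 <= C * matching_rate d L ^+ 2 /\
    L^-1 <= C * matching_rate d L.
Proof.
rewrite leq_eqVlt => /orP[/eqP <-|d3].
  have l2 : 0 < ln 2 :> R by rewrite ln_gt0// ltr1n.
  (* The 6 is [3 / 2 * 4]: [1 + K] is at most [3 / (2 * ln 2) * ln L], using [ln 2 <= ln L], and [L]
     is at most 4 times the number of cells. The added 1 serves the second bound. *)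
  exists (1 + 6 / ln 2); first by rewrite lerDl divr_ge0// ltW.
  move=> L K L2 /andP[KL LK]; have L0 : 0 < L by lra.
  have lL : ln 2 <= ln L by rewrite ler_ln ?posrE.
  have lL0 : 0 < ln L by exact: lt_le_trans lL.
  have r2 : matching_rate 2 L ^+ 2 = ln L / L.
    by rewrite /matching_rate eqxx expr_div_n !sqr_sqrtr// ltW.
  have m0 : 0 < (2 ^+ K) ^+ 2 :> R by rewrite !exprn_gt0.
  have KL2 : K%:R * ln 2 * 2 <= ln L.
    have : ln ((2 ^+ K) ^+ 2) <= ln L by rewrite ler_ln ?posrE.
    by rewrite !lnXn ?exprn_gt0// mulr_natl mulr_natr.
  split.
    rewrite r2 (eq_bigr (fun=> 1)) => [|k _]; last first.
      by rewrite -natrX divff ?expr1n.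
    rewrite sumr_const card_ord.
    have K1 : 1 + K%:R <= 3 / (2 * ln 2) * ln L.
      by rewrite mulrAC ler_pdivlMr ?mulr_gt0//; nra.
    have mL : ((2 ^+ K) ^+ 2)^-1 <= 4 / L :> R.
      rewrite -[leRHS]invrK invf_div lef_pV2 ?posrE ?divr_gt0//.
      rewrite ler_pdivrMr//; apply: (le_trans (ltW LK)).
      rewrite (_ : (2 ^+ K.+1) ^+ 2 = (2 ^+ K) ^+ 2 * 4)//.
      by rewrite (exprS 2 K); ring.
    have K0 : 0 <= 1 + K%:R :> R by rewrite addr_ge0.
    apply: (@le_trans _ _ (3 / (2 * ln 2) * ln L * (4 / L))).
      by apply: ler_pM => //; rewrite invr_ge0 ltW.
    have -> : 3 / (2 * ln 2) * ln L * (4 / L) = 6 / ln 2 * (ln L / L).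
      by field; rewrite !gt_eqF.
    by rewrite ler_wpM2r ?divr_ge0 ?(ltW lL0) ?(ltW L0)// lerDr.
  have r0 := matching_rate_gt0 2 L2.
  have C0 : 1 <= 1 + 6 / ln 2 :> R by rewrite lerDl divr_ge0// ltW.
  rewrite -(@ler_pXn2r _ 2)// ?nnegrE ?invr_ge0 ?mulr_ge0 ?(ltW L0) ?(ltW r0)//;
    last by rewrite (le_trans ler01 C0).
  rewrite exprMn r2 mulrA ler_pdivlMr//.
  have -> : L^-1 ^+ 2 * L = L^-1 by field; rewrite gt_eqF.
  apply: (@le_trans _ _ 1); first by rewrite invf_le1//; lra.
  apply: (@le_trans _ _ ((1 + 6 / ln 2) * ln 2)).
    by rewrite mulrDl mul1r divfK ?gt_eqF//; lra.
  apply: ler_pM => //; [lra|exact: ltW|].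
  by rewrite expr2 ler_peMl//; lra.
(* Here [1 + \sum] is at most 3, and [(2 ^+ K)^-1 <= 2 * r] contributes a factor 4 after
   squaring. *)
exists 12; first by rewrite ler1n.
move=> L K L2 /andP[KL LK]; have L0 : 0 < L by lra.
have d0 : (0 < d)%N by exact: leq_trans d3.
have r0 := matching_rate_gt0 d L2.
have rE : matching_rate d L ^+ d = L^-1.
  rewrite /matching_rate gtn_eqF// exprVn -powR_mulrn ?powR_ge0// -powRrM.
  by rewrite mulVf ?pnatr_eq0 -?lt0n// powRr1// ltW.
set r := matching_rate d L in r0 rE *.
have m0 : 0 < 2 ^+ K :> R by rewrite exprn_gt0.
have mr : (2 ^+ K)^-1 <= 2 * r.
  have : (2 ^+ K.+1)^-1 <= r.
    rewrite -(@ler_pXn2r _ d)// ?nnegrE ?invr_ge0 ?exprn_ge0 ?(ltW r0)//.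
    by rewrite rE exprVn lef_pV2 ?posrE ?exprn_gt0// ltW.
  by rewrite exprS invfM ler_pdivrMl.
have G2 : \sum_(k < K) (4 / 2 ^+ d) ^+ k <= 2 :> R.
  have q0 : 0 <= 4 / 2 ^+ d :> R by rewrite divr_ge0// exprn_ge0.
  have q1 : 4 / 2 ^+ d <= 1 / 2 :> R.
    rewrite ler_pdivrMr ?exprn_gt0//.
    have : 2 ^+ 3 <= 2 ^+ d :> R by rewrite ler_weXn2l// ler1n.
    by lra.
  set q := 4 / _ in q0 q1 *.
  have : (1 - q) * (\sum_(k < K) q ^+ k) <= 1.
    have -> : (1 - q) * (\sum_(i < K) q ^+ i) = 1 - q ^+ K.
      by rewrite -opprB mulNr -subrX1 opprB.
    by rewrite lerBlDr lerDl exprn_ge0.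
  have : 0 <= \sum_(k < K) q ^+ k by apply: sumr_ge0 => i _; rewrite exprn_ge0.
  by nra.
split.
  have -> : 12 * r ^+ 2 = 3 * (2 * r) ^+ 2 by ring.
  rewrite -[((2 ^+ K) ^+ 2)^-1]exprVn; apply: ler_pM.
  - by rewrite addr_ge0// sumr_ge0// => k _; rewrite exprn_ge0// divr_ge0// exprn_ge0.
  - by rewrite sqr_ge0.
  - by lra.
  - by rewrite lerXn2r ?nnegrE ?mulr_ge0 ?invr_ge0 ?(ltW m0) ?(ltW r0).
have r1 : r <= 1.
  rewrite -(@ler_pXn2r _ d)// ?nnegrE ?(ltW r0)// rE expr1n invf_le1//; lra.
apply: (@le_trans _ _ r); last by lra.
by rewrite -rE -(prednK d0) exprS ler_piMr ?(ltW r0)// exprn_ile1// ltW.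
Qed.

End rate.

Theorem theorem4 (R : realType) (d : nat) (d2 : (2 <= d)%N)
    (disp : measure_display) (T : measurableType disp) (P : probability T R)
    (Xi : T -> set 'rV[R]_d)
    (ppXi : point_process Xi) (homXi : homogeneous P Xi)
    (Omega : set 'rV[R]_d) (Omega0 : Omega !=set0) (oOmega : open Omega)
    (bOmega : bounded_set Omega) (cOmega : convex_set Omega)
    (varXi : exists2 C0 : R, 0 < C0 &
      forall L : R, 1 <= L ->
      forall f : 'rV[R]_d -> R, f \_ Omega \in Lfun (lebesgue_rV d) 2%:E ->
      ('V_P[fun w => (\sum_(x \in dilation L Xi w) (f \_ Omega) x)%R]
       <= (C0 * L)%:E * 'N[lebesgue_rV d]_2%:E[EFin \o f \_ Omega] ^+ 2)%E) :
  exists C L0 : R, [/\ 0 < C, 2 <= L0 &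
    forall L : R, L0 <= L ->
    (\int[P]_w W2_error (measurable_open_rV oOmega) (dilation L Xi w)
     <= (if d == 2%N then C * Num.sqrt (ln L) / Num.sqrt L
         else C / L `^ d%:R^-1)%:E)%E].
Proof.
have [c c0 hom] := homXi; have [C0 C00 var] := varXi.
have [c1 [c2 [c3 [c10 c20 c30 cells]]]] := cell_decomposition Omega0 oOmega bOmega cOmega.
have [Cr Cr1 rate] := @matching_rate_ge R d d2.
have [B B0 diamB] : exists2 B : R, 0 <= B & forall x y, Omega x -> Omega y -> enorm (y - x) <= B.
  have [b [_ hb]] := bOmega.
  exists (Num.sqrt (d%:R * (2 * (b + 1)) ^+ 2)); first exact: sqrtr_ge0.
  move=> x y Ox Oy; rewrite -[leLHS]ger0_norm ?sqrtr_ge0// -sqrtr_sqr ler_wsqrtr//.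
  apply: (le_trans (enorm_sqr_le _)); rewrite ler_wpM2l//.
  have hx z : Omega z -> `|z| <= b + 1 by apply: hb; rewrite ltrDl.
  have b1 : 0 <= b + 1 by apply: le_trans (hx _ Ox).
  rewrite lerXn2r ?nnegrE ?mulr_ge0// (le_trans (ler_normB _ _))//.
  by have := hx _ Ox; have := hx _ Oy; lra.
pose V := fine (lebesgue_rV d Omega).
(* [k3] collects the factors of the flux term other than [m ^+ d / L] and the sum over scales:
   [2 * d%:R * V / c1] from the density bound, 4 from [N > EN / 2], [2 * d%:R] faces per cell, and
   [4 * 2 ^+ d * C0 * c2] from the variance. [k4] is the constant of the term with few points. *)
pose k3 := 64 * d%:R ^+ 2 * 2 ^+ d * C0 * c2 / (c1 * c ^+ 2 * V).
pose k4 := 4 * B * C0 / (c ^+ 2 * V).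
pose C := (1 + 81 * d%:R * c3 ^+ 2 * (1 + k3) + k4) * Cr.
have cellsK K : exists (cell : {ffun 'I_d -> 'I_(2 ^ K)} -> set 'rV[R]_d) pt vol,
    [/\ [/\ forall k, measurable (cell k), trivIset setT cell, \bigcup_k cell k = Omega
      & forall k, lebesgue_rV d (cell k) = (vol k)%:E],
      forall k, c1 / (2 ^+ K) ^+ d <= vol k <= c2 / (2 ^+ K) ^+ d,
      forall k x, cell k x -> `|x - pt k| <= c3 / 2 ^+ K,
      forall i k l, next_cell i k l -> `|pt k - pt l| <= c3 / 2 ^+ K
      & 0 < V /\ \sum_k vol k = V].
  have m0 : (0 < 2 ^ K)%N by rewrite expn_gt0.
  have [cell [pt [mcell tcell ccell vcell [cpt npt]]]] := cells _ m0.
  rewrite natrX in vcell cpt npt.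
  exists cell, pt, (fun k => fine (lebesgue_rV d (cell k))).
  have vE k : lebesgue_rV d (cell k) = (fine (lebesgue_rV d (cell k)))%:E.
    rewrite fineK// ge0_fin_numE//; have /andP[_] := vcell k.
    by move=> /le_lt_trans; apply; exact: ltry.
  have vlu k : c1 / (2 ^+ K) ^+ d <= fine (lebesgue_rV d (cell k)) <= c2 / (2 ^+ K) ^+ d.
    by have := vcell k; rewrite {1 2}vE !lee_fin.
  split=> //.
  have sV : \sum_k fine (lebesgue_rV d (cell k)) = V.
    by rewrite /V (lebesgue_cells mcell tcell ccell vE (measurable_open_rV oOmega)).
  split=> //; rewrite -sV.
  have [x] := Omega0; rewrite -ccell => -[k _ _].
  have v0 l : 0 < fine (lebesgue_rV d (cell l)).
    have /andP[h _] := vlu l; apply: lt_le_trans h.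
    by rewrite divr_gt0// exprn_gt0// exprn_gt0.
  by rewrite (bigD1 k)//= ltr_wpDr// sumr_ge0// => l _; exact: ltW.
have V0 : 0 < V by have [? [? [? [_ _ _ _ []]]]] := cellsK 0%N.
have k30 : 0 <= k3.
  rewrite divr_ge0//; last by rewrite !mulr_ge0 ?sqr_ge0// ltW.
  by rewrite !mulr_ge0 ?sqr_ge0 ?exprn_ge0 ?(ltW C00) ?(ltW c20).
have k40 : 0 <= k4.
  rewrite divr_ge0//; last by rewrite mulr_ge0 ?sqr_ge0// ltW.
  by rewrite mulr_ge0 ?(ltW C00)// mulr_ge0.
have a0 : 0 <= 81 * d%:R * c3 ^+ 2 * (1 + k3).
  by rewrite mulr_ge0 ?addr_ge0// mulr_ge0 ?sqr_ge0// mulr_ge0.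
exists C, 2; split=> // [|L L2].
  rewrite mulr_gt0//; last by lra.
  by rewrite -addrA ltr_wpDr// addr_ge0.
have L0 : 0 < L by lra.
have [|K KL] := @dyadic_scale R d L (ltnW d2); first by lra.
have [rate1 rate2] := rate L K L2 KL.
have r0 := @matching_rate_gt0 R d L L2.
set r := matching_rate d L in rate1 rate2 r0.
have -> : (if d == 2%N then C * Num.sqrt (ln L) / Num.sqrt L else C / L `^ d%:R^-1) = C * r.
  by rewrite /r /matching_rate; case: ifPn => // _; rewrite mulrA.
have [cell [pt [vol [[mcell tcell ccell vcell] vlu cpt npt [_ sV]]]]] := cellsK K.
have m0 : 0 < 2 ^+ K :> R by rewrite exprn_gt0.
have md0 : 0 < (2 ^+ K) ^+ d :> R by rewrite exprn_gt0.
have varL := var L (le_trans (ler1n R 2) L2).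
have v00 : 0 < c1 / (2 ^+ K) ^+ d by rewrite divr_gt0.
have vl k : c1 / (2 ^+ K) ^+ d <= vol k by case/andP: (vlu k).
have vu k : vol k <= c2 / (2 ^+ K) ^+ d by case/andP: (vlu k).
have h0 : 0 < c3 / 2 ^+ K by rewrite divr_gt0.
apply: (le_trans (expected_W2_error_le d2 ppXi oOmega bOmega Omega0 L0 c0 C00 hom varL
  mcell tcell ccell vcell v00 vl vu h0 cpt npt B0 diamB r0)).
rewrite lee_fin sV /error_constant.
set G := \sum_(k < K) _ in rate1 *.
have G0 : 0 <= G.
  by apply: sumr_ge0 => k _; rewrite exprn_ge0// divr_ge0// exprn_ge0.
set m := 2 ^+ K in rate1 m0 md0 KL *.
have -> : ((2 ^ K) ^ d * d * 2)%:R = m ^+ d * d%:R * 2 :> R by rewrite !natrM !natrX.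
have p2 : 0 < 2 ^+ d :> R by rewrite exprn_gt0.
set e := 81 * d%:R * (c3 / m) ^+ 2 / r.
have -> : r / 2 + e + e * (2 * d%:R * V / (c1 / m ^+ d)) * (4 / (c * L * V) ^+ 2) *
    (m ^+ d * d%:R * 2 * (C0 * L * (c2 / m ^+ d * (4 * 2 ^+ d * G)))) +
    4 * B / (c * L * V) ^+ 2 * (C0 * L * V) =
    r / 2 + e * (1 + k3 * (m ^+ d / L) * G) + k4 * L^-1.
  rewrite /k3 /k4; field.
  by rewrite !gt_eqF.
have e0 : 0 <= e by rewrite divr_ge0 ?(ltW r0)// mulr_ge0 ?sqr_ge0// mulr_ge0.
(* This limits the refinement of the grid: there are at most [L] cells, so the expected number of
   points per cell stays bounded below. *)
have mL : m ^+ d / L <= 1 by rewrite ler_pdivrMr// mul1r; case/andP: KL.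
have t1 : e * (1 + k3 * (m ^+ d / L) * G) <= 81 * d%:R * c3 ^+ 2 * (1 + k3) * (Cr * r).
  apply: (@le_trans _ _ (e * ((1 + k3) * (1 + G)))).
    apply: ler_wpM2l => //.
    have : k3 * (m ^+ d / L) * G <= k3 * G.
      by rewrite ler_wpM2r// ler_piMr.
    have : 0 <= k3 * G by rewrite mulr_ge0.
    by rewrite mulrDl mul1r mulrDr mulr1; lra.
  have -> : e * ((1 + k3) * (1 + G)) =
      81 * d%:R * c3 ^+ 2 * (1 + k3) * ((1 + G) / m ^+ 2 / r).
    by rewrite /e; field; rewrite !gt_eqF.
  apply: ler_wpM2l => //.
  by rewrite ler_pdivrMr// -mulrA -expr2.
have t2 : k4 * L^-1 <= k4 * (Cr * r) by rewrite ler_wpM2l.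
have t3 : r / 2 <= Cr * r.
  apply: (@le_trans _ _ (1 * r)); last by rewrite ler_pM2r.
  by lra.
rewrite /C -mulrA !mulrDl mul1r; lra.
Qed.
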